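(* Let $F:\mathbb{C}^n\to\mathbb{C}^n$ be a power series mapping with components $F_i(X_1,\dots,X_n):=X_i-\sum_{\alpha\ne0}\frac{H_{i,\alpha}}{\alpha!}X^\alpha$ converging in a neighbourhood of $0$, and suppose $\sum_{k=0}^\infty A^k$ converges, where $A_{i,j}=H_{i,\mathbf{e}_j}$. Then $F$ has an analytic inverse with $F_i^{-1}(X_1,\dots,X_n)=\sum_{\alpha\ne0}g_{i,\alpha}X^\alpha$, where $$g_{i,\alpha}:=\sum_{\mathcal{T}\in\mathbb{S}_{i,\alpha}}\ \prod_{v\text{ internal vertex of }\mathcal{T}}\frac{H_{\tau(v),\mu(v)}}{|\mu(v)|!}.$$
   Context: For $\alpha\in\mathbb{Z}^n_{\ge0}$: $\alpha!=\alpha_1!\cdots\alpha_n!$, $|\alpha|=\alpha_1+\dots+\alpha_n$, $X^\alpha=X_1^{\alpha_1}\cdots X_n^{\alpha_n}$; $\mathbf{e}_j$ is the $j$-th unit multi-index. An $n$-type tree $\mathcal{T}=(T,\tau)$ is a finite rooted planar tree (children ordered left to right, any finite number of children) with types $\tau:V\to[n]$; no constraint is imposed on the order of types among siblings. A vertex is internal if it has a child; for internal $v$, $\mu(v)\in\mathbb{Z}^n_{\ge0}$ counts its children of each type, so $|\mu(v)|$ is its number of children. $\mathbb{S}_{i,\alpha}$ is the set of such $n$-type trees with root type $i$ and exactly $\alpha_j$ leaves of type $j$ for each $j$. *)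

(* Defs.v *)
From HB Require Import structures.
From mathcomp Require Import all_boot all_order all_algebra.
From mathcomp Require Import all_classical all_reals all_analysis.
From mathcomp Require Export complex.
Export Order.TTheory GRing.Theory Num.Theory.
Export numFieldNormedType.Exports.

Set Implicit Arguments.
Unset Strict Implicit.
Unset Printing Implicit Defensive.

Local Open Scope classical_set_scope.
Local Open Scope ring_scope.

(* Topology / norm on C := R[i]: the metric topology of its absolute value. *)
HB.instance Definition _ (R : rcfType) := NormedModule.copy R[i] (R[i])^o.

Definition mi (n : nat) := {ffun 'I_n -> nat}.

Definition mi0 {n} : mi n := [ffun => 0%N].
Definition mie {n} (j : 'I_n) : mi n := [ffun k => nat_of_bool (k == j)].
Definition msize {n} (a : mi n) : nat := (\sum_(k < n) a k)%N.
Definition mfact {n} (a : mi n) : nat := (\prod_(k < n) (a k)`!)%N.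
Definition mon {C : comPzRingType} {n} (a : mi n) (x : 'I_n -> C) : C :=
  \prod_(k < n) x k ^+ a k.

Section PowerSeries.
Variables (R : realType) (n : nat).
Local Notation C := R[i].

Definition mi_of (N : nat) (b : {ffun 'I_n -> 'I_N.+1}) : mi n :=
  [ffun k => nat_of_ord (b k)].

Definition psum (c : mi n -> C) (x : 'I_n -> C) (N : nat) : C :=
  \sum_(b : {ffun 'I_n -> 'I_N.+1} | (\sum_(k < n) (b k : nat) <= N)%N)
     c (mi_of b) * mon (mi_of b) x.

Definition pabssum (c : mi n -> C) (x : 'I_n -> C) (N : nat) : C :=
  \sum_(b : {ffun 'I_n -> 'I_N.+1} | (\sum_(k < n) (b k : nat) <= N)%N)
     `|c (mi_of b) * mon (mi_of b) x|.

Definition ps_val (c : mi n -> C) (x : 'I_n -> C) (v : C) : Prop :=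
  (exists M : C, forall N, pabssum c x N <= M) /\ (psum c x N @[N --> \oo] --> v).

Definition polydisc (r : C) (x : 'I_n -> C) : Prop := forall k, `|x k| < r.

Definition hcoef (H : 'I_n -> mi n -> C) (i : 'I_n) (a : mi n) : C :=
  if a == mi0 then 0 else H i a / (mfact a)%:R.

Definition Fval (H : 'I_n -> mi n -> C) (x y : 'I_n -> C) : Prop :=
  forall i, exists v, ps_val (hcoef H i) x v /\ y i = x i - v.

Definition Amat (H : 'I_n -> mi n -> C) : 'M[C]_n :=
  \matrix_(i, j) H i (mie j).

End PowerSeries.

Inductive ntree (n : nat) := Node of 'I_n & seq (ntree n).
Arguments Node {n}.

Section Trees.
Variable n : nat.

Fixpoint tenc (t : ntree n) : GenTree.tree 'I_n :=
  let: Node j cs := t in GenTree.Node 0 (GenTree.Leaf j :: map tenc cs).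

Fixpoint tdec (g : GenTree.tree 'I_n) : option (ntree n) :=
  match g with
  | GenTree.Node _ (GenTree.Leaf j :: cs) => Some (Node j (pmap tdec cs))
  | _ => None
  end.

Lemma tencK : pcancel tenc tdec.
Proof.
rewrite /pcancel; fix IH 1 => -[j cs] /=; congr (Some (Node j _)).
elim: cs => //= c cs IHcs; by rewrite IH IHcs.
Qed.

HB.instance Definition _ := Countable.copy (ntree n) (pcan_type tencK).

Definition rtype (t : ntree n) : 'I_n := let: Node j _ := t in j.

Fixpoint nverts (t : ntree n) : nat :=
  let: Node _ cs := t in (sumn (map nverts cs)).+1.

Fixpoint leafvec (t : ntree n) : mi n :=
  let: Node j cs := t in
  if cs is [::] then mie j
  else [ffun k => sumn (map (fun c => leafvec c k) cs)].

Definition mu (cs : seq (ntree n)) : mi n :=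
  [ffun k => count (fun c => rtype c == k) cs].

Variable (R : realType) (H : 'I_n -> mi n -> R[i]).

Fixpoint tweight (t : ntree n) : R[i] :=
  let: Node j cs := t in
  if cs is [::] then 1
  else H j (mu cs) / (size cs)`!%:R * \prod_(w <- map tweight cs) w.

(* trees of S_{i,alpha} with exactly N vertices (a finite set) *)
Definition Sset (i : 'I_n) (a : mi n) (N : nat) : set (ntree n) :=
  [set t | rtype t = i /\ leafvec t = a /\ nverts t = N].

Definition gblock (i : 'I_n) (a : mi n) (N : nat) : R[i] :=
  \sum_(t \in Sset i a N) tweight t.

Definition gpartial (i : 'I_n) (a : mi n) (N : nat) : R[i] :=
  \sum_(k < N) gblock i a k.

End Trees.

(* Main.v *)
(** The sums of tree weights are organised by the number N of vertices rather than
by absolute convergence over all trees: unary vertices carry the matrix A, and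
only the powers of A, not those of its entrywise absolute values, are summable.
Let P_i(N) be the sum over trees with root type i and N vertices of the weight
times the monomial of the leaves. Cutting off the root gives
P(N+1) = [N = 0] y + A P(N) + Q(N), where Q(N) collects products of at least two
factors, hence P(N+1) = A^N y + sum_k A^(N-k) Q(k). Since A^k tends to 0, there is
tau > 1 with sum_k |A^k| tau^k finite, and induction on D bounds
sum_(N < D) |P(N)| tau^N by a small s0 once y is small. Applied to the l1 norm on
polynomials this bounds the coefficients g; applied to the value at y it lets
x = sum_N P(N) be substituted into the power series h = id - F, giving
h(x) = x - y. Finally F is injective near 0: if F(x) = F(z) then d = x - z satisfies
d = A d + O(s0 |d|), and iterating this until |A^N| is small forces d = 0. *)

Require Import Defs.
From HB Require Import structures.
From mathcomp Require Import all_boot all_order all_algebra.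
From mathcomp Require Import all_classical all_reals all_analysis.
From mathcomp Require Import complex.
From mathcomp Require Import ring lra.
From mathcomp Require mpoly.
Import Order.TTheory GRing.Theory Num.Theory.
Import numFieldNormedType.Exports.
Local Open Scope classical_set_scope.
Local Open Scope ring_scope.

Set Implicit Arguments.
Unset Strict Implicit.
Unset Printing Implicit Defensive.

(** * Words and tree enumeration *)

Section Words.
Variable n : nat.
Implicit Types (js : seq 'I_n) (a : mi n).

Definition cont js : mi n := [ffun k => count_mem k js].

(** Children are ordered, so the types below a vertex form a word; words replace multi-indices from
    here on. *)
Fixpoint words (m : nat) : seq (seq 'I_n) :=
  if m is m'.+1 then [seq j :: js | j <- enum 'I_n, js <- words m']
  else [:: [::]].

Lemma mem_words m js : (js \in words m) = (size js == m).
Proof.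
elim: m js => [|m IH] [|j js] //=.
  by apply/allpairsP => -[] [] ? ? [].
rewrite eqSS -IH; apply/allpairsP/idP => [[[k s]] /= [_ ks [_ ->]] //|jsm].
by exists (j, js); rewrite mem_enum.
Qed.

Lemma sum_wordsS (V : nmodType) m (f : seq 'I_n -> V) :
  \sum_(js <- words m.+1) f js = \sum_j \sum_(js <- words m) f (j :: js).
Proof. by rewrite /= big_allpairs_dep big_enum. Qed.

Lemma words_uniq m : uniq (words m).
Proof.
elim: m => //= m IH; apply: allpairs_uniq => //; first exact: enum_uniq.
by move=> [? ?] [? ?] _ _ /= [-> ->].
Qed.

Lemma msize_cont js : msize (cont js) = size js.
Proof.
rewrite /msize; under eq_bigr do rewrite ffunE.
elim: js => [|j js IH] /=; first by rewrite big1.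
rewrite big_split /= IH (bigD1 j) //= eqxx big1 ?addn0 ?add1n // => k.
by rewrite eq_sym => /negbTE ->.
Qed.

Lemma mon_cont (A : comPzRingType) (z : 'I_n -> A) js :
  mon (cont js) z = \prod_(j <- js) z j.
Proof.
transitivity (\prod_(k < n) z k ^+ count_mem k js).
  by apply: eq_bigr => k _; rewrite ffunE.
elim: js => [|j js IH] /=; first by rewrite big_nil big1.
rewrite big_cons -IH.
transitivity (\prod_(k < n) (z k ^+ (j == k) * z k ^+ count_mem k js)).
  by apply: eq_bigr => k _; rewrite exprD.
rewrite big_split /=; congr (_ * _).
rewrite (bigD1 j) //= eqxx expr1 big1 ?mulr1 // => k.
by rewrite eq_sym => /negbTE ->; rewrite expr0.
Qed.

(** The multinomial count, by induction on the first letter. Words of content a starting with j are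
    the words of content a - e_j; times a! they count a_j * m!, and summing over j gives (m+1) *
    m!. *)
Lemma card_cont m a : msize a = m ->
  ((\sum_(js <- words m) (cont js == a)) * mfact a)%N = m`!.
Proof.
elim: m a => [|m IH] a sa.
  have a0 k : a k = 0%N.
    apply/eqP; rewrite -leqn0; move: sa; rewrite /msize (bigD1 k) //= => <-.
    exact: leq_addr.
  rewrite big_seq1 (_ : cont _ == a) ?mul1n.
    by rewrite /mfact big1 // => k _; rewrite a0.
  by apply/eqP/ffunP => k; rewrite ffunE a0.
rewrite (@sum_wordsS nat m (fun js => nat_of_bool (cont js == a))) big_distrl /=.
rewrite (eq_bigr (fun j => (a j * m`!)%N)); first by rewrite -big_distrl /= factS -sa.
move=> j _; case aj: (a j) => [|c].
  rewrite big1 ?mul0n // => js _.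
  case: eqP => // /ffunP /(_ j); by rewrite ffunE aj /= eqxx.
pose b : mi n := [ffun k => (a k - (k == j))%N].
have sb : msize b = m.
  move: sa; rewrite /msize (bigD1 j) //= aj addSn => -[<-].
  rewrite (bigD1 j) //= ffunE eqxx aj subn1; congr addn.
  by apply: eq_bigr => k /negbTE kj; rewrite ffunE kj subn0.
rewrite -(IH b sb) -mulnC mulnA.
have -> : mfact a = (c.+1 * mfact b)%N.
  rewrite /mfact (bigD1 j) //= [in RHS](bigD1 j) //= aj ffunE eqxx aj subn1 /=.
  rewrite factS -!mulnA; congr (_ * (_ * _))%N.
  by apply: eq_bigr => k /negbTE kj; rewrite ffunE kj subn0.
rewrite -[in RHS]mulnA [in RHS](mulnC _ (mfact b)) mulnA; congr (_ * _)%N.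
apply: eq_bigr => js _; congr nat_of_bool.
apply/eqP/eqP => /ffunP e; apply/ffunP => k; move: (e k); rewrite !ffunE /=.
  by move=> <-; rewrite (eq_sym k j) addKn.
move=> ->; rewrite (eq_sym j k) addnC subnK //.
by case: eqP => [->|//]; rewrite aj.
Qed.

Lemma mi_of_inj N : injective (@mi_of n N).
Proof.
move=> b c /ffunP e; apply/ffunP => k; apply: val_inj.
by move: (e k); rewrite !ffunE.
Qed.

Lemma mi_of_exists N a : (msize a <= N)%N ->
  exists b : {ffun 'I_n -> 'I_N.+1}, mi_of b = a.
Proof.
move=> aN; exists [ffun k => inord (a k)]; apply/ffunP => k.
rewrite !ffunE inordK // ltnS; apply: leq_trans aN.
by rewrite /msize (bigD1 k) //= leq_addr.
Qed.

Lemma msize_mi_of N (b : {ffun 'I_n -> 'I_N.+1}) :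
  msize (mi_of b) = (\sum_(k < n) b k)%N.
Proof. by apply: eq_bigr => k _; rewrite ffunE. Qed.

(* The words of content a number |a|! / a!, so a sum over multi-indices becomes
   a sum over words once each word carries the reciprocal weight. *)
Lemma sum_mi_words (F : numFieldType) (f : mi n -> F) N :
  \sum_(b : {ffun 'I_n -> 'I_N.+1} | (\sum_(k < n) (b k : nat) <= N)%N)
      f (mi_of b) =
  \sum_(m < N.+1) \sum_(js <- words m)
      (mfact (cont js))%:R / m`!%:R * f (cont js).
Proof.
pose G m a : F := (mfact a)%:R / m`!%:R * f a.
rewrite (partition_big (fun b : {ffun 'I_n -> 'I_N.+1} => inord (msize (mi_of b)) : 'I_N.+1) xpredT) //=.
apply: eq_bigr => m _.
(* Double counting: an indicator pairs each word with its unique content, and exchanging the sums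
   lets [card_cont] count the words of a given content. *)
transitivity (\sum_(js <- words m)
    \sum_(b : {ffun 'I_n -> 'I_N.+1} | msize (mi_of b) == m)
      (cont js == mi_of b)%:R * G m (mi_of b)); last first.
  rewrite big_seq [RHS]big_seq; apply: eq_bigr => js; rewrite mem_words => /eqP sjs.
  have [|b eb] := @mi_of_exists N (cont js).
    by rewrite msize_cont sjs -ltnS.
  rewrite (bigD1 b) /= ?eb ?msize_cont ?sjs // eqxx mul1r big1 ?addr0 // => c.
  case/andP => _ cb; rewrite -eb (inj_eq (@mi_of_inj N)) eq_sym (negbTE cb).
  by rewrite mul0r.
rewrite exchange_big /=.
transitivity (\sum_(b : {ffun 'I_n -> 'I_N.+1} | msize (mi_of b) == m) f (mi_of b)).
  apply: eq_bigl => b; rewrite -msize_mi_of.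
  apply/andP/eqP => [[bN /eqP <-]|bm]; first by rewrite inordK.
  rewrite bm -ltnS ltn_ord; split => //; apply/eqP.
  exact: inord_val.
apply: eq_bigr => b /eqP bm; rewrite -mulr_suml -natr_sum /G !mulrA -natrM.
by rewrite card_cont // divff ?mul1r // pnatr_eq0 -lt0n fact_gt0.
Qed.

End Words.
Arguments words : simpl never.

(** * Enumeration of trees and forests by number of vertices *)

Section TreeEnumeration.
Local Open Scope nat_scope.
Variable n : nat.
Implicit Types (t : ntree n) (f : seq (ntree n)) (js : seq 'I_n).

(** The tree enumerator [T] is a parameter, so that the recursion of [trees_upto] can pass itself
    with less fuel. *)
Fixpoint forests (T : 'I_n -> nat -> seq (ntree n)) js N : seq (seq (ntree n)) :=
  if js is j :: js' then
    [seq t :: f | t <- flatten [seq T j k | k <- iota 0 N.+1],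
                  f <- forests T js' (N - nverts t)]
  else if N == 0 then [:: [::]] else [::].

(** Here d is fuel making the recursion structural; the list is complete as soon as N <= d. *)
Fixpoint trees_upto (d : nat) (i : 'I_n) (N : nat) : seq (ntree n) :=
  if d is d'.+1 then
    if N is N'.+1 then
      (if N' == 0 then [:: Node i [::]] else [::]) ++
      [seq Node i f | js <- flatten [seq words n m | m <- iota 1 N'],
                      f <- forests (trees_upto d') js N']
    else [::]
  else [::].

Definition trees i N := trees_upto N i N.

Lemma nverts_gt0 t : (0 < nverts t)%N.
Proof. by case: t. Qed.

Lemma size_le_sumn_nverts f : (size f <= sumn (map (@nverts n) f))%N.
Proof.
by elim: f => //= t f IH; rewrite -addn1 addnC leq_add // nverts_gt0.
Qed.

(** Correctness is only asked up to size N, which is all that limited fuel provides. *)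
Definition enumerates (T : 'I_n -> nat -> seq (ntree n)) N :=
  forall i k, (k <= N)%N ->
    uniq (T i k) /\ forall t, (t \in T i k) = (rtype t == i) && (nverts t == k).

Lemma mem_layers T j N t : enumerates T N ->
  (t \in flatten [seq T j k | k <- iota 0 N.+1]) =
  (rtype t == j) && (nverts t <= N)%N.
Proof.
move=> TN; apply/flatten_mapP/andP => [[k]|[tj tN]].
  by rewrite mem_iota /= add0n ltnS => kN; rewrite (TN _ _ kN).2 => /andP[-> /eqP ->].
by exists (nverts t); rewrite ?mem_iota ?add0n ?ltnS //= (TN _ _ tN).2 tj eqxx.
Qed.

Lemma enumeratesW T N M : (M <= N)%N -> enumerates T N -> enumerates T M.
Proof. by move=> MN TN i k kM; apply: TN; apply: leq_trans MN. Qed.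

Lemma mem_forests T js N f : enumerates T N ->
  (f \in forests T js N) =
  (map (@rtype n) f == js) && (sumn (map (@nverts n) f) == N).
Proof.
elim: js N f => [|j js IH] N f TN /=.
  case: eqP => [->|N0]; rewrite ?inE.
    by case: f => //= t f; rewrite andbF.
  by case: f => //=; rewrite eq_sym; case: eqP.
apply/allpairsPdep/andP => [[t [g [ht hg ->]]]|[/eqP fj /eqP fN]].
  move: ht; rewrite mem_layers // => /andP[/eqP tj tN].
  move: hg; rewrite IH; last by apply: enumeratesW TN; exact: leq_subr.
  by move=> /andP[/eqP <- /eqP gN] /=; rewrite tj eqxx gN subnKC.
case: f fj fN => //= t f [tj fj] fN; exists t, f; split => //.
  by rewrite mem_layers // tj eqxx -fN leq_addr.
rewrite IH; last by apply: enumeratesW TN; exact: leq_subr.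
by rewrite fj eqxx -fN addKn /=.
Qed.

(** Layers are disjoint because the number of vertices of a tree determines its layer. *)
Lemma layers_uniq T j N M : enumerates T N -> (M <= N.+1)%N ->
  uniq (flatten [seq T j k | k <- iota 0 M]).
Proof.
move=> TN MN; rewrite -[X in flatten X]/(map _ _) -[X in uniq X]map_id.
rewrite map_flatten -map_comp.
apply: (@allpairs_uniq_dep _ _ _ (fun _ t => t) (iota 0 M) (T j)).
- exact: iota_uniq.
- move=> k; rewrite mem_iota add0n => /andP[_ kM].
  by apply: (TN _ _ _).1; rewrite -ltnS; apply: leq_trans MN.
move=> x y /allpairsPdep[k [t [hk ht ->]]] /allpairsPdep[l [u [hl hu ->]]] /= tu.
subst u; move: hk hl ht hu; rewrite !mem_iota !add0n => /andP[_ hk] /andP[_ hl].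
have le m : (m < M)%N -> (m <= N)%N by move=> mM; rewrite -ltnS; apply: leq_trans MN.
rewrite (TN _ _ (le _ hk)).2 (TN _ _ (le _ hl)).2.
by move=> /andP[_ /eqP <-] /andP[_ /eqP <-].
Qed.

Lemma forests_uniq T js N : enumerates T N -> uniq (forests T js N).
Proof.
elim: js N => [|j js IH] N TN /=; first by case: ifP.
apply: allpairs_uniq_dep.
- exact: (@layers_uniq T j N N.+1).
- by move=> t _; apply: IH; apply: enumeratesW TN; exact: leq_subr.
by move=> [t f] [u g] _ _ /= [-> ->].
Qed.

Lemma trees_uptoP d : enumerates (trees_upto d) d.
Proof.
elim: d => [|d IH] i N Nd /=.
  split=> // t; move: Nd; rewrite leqn0 => /eqP ->.
  by rewrite in_nil; case: t => ? ?; rewrite andbF.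
case: N Nd => [|N] Nd; first by split=> // -[? ?]; rewrite in_nil andbF.
have TN : enumerates (trees_upto d) N by apply: enumeratesW IH.
(* Each tree has a vertex, so a nonempty forest with N vertices has between 1 and N trees; longer
   words need not be listed. *)
have wordsP js : (js \in flatten [seq words n m | m <- iota 1 N]) =
    (0 < size js <= N)%N.
  apply/flatten_mapP/idP => [[m]|hs].
    by rewrite mem_iota add1n ltnS mem_words => hm /eqP ->.
  by exists (size js); rewrite ?mem_words // mem_iota add1n ltnS.
split.
  rewrite cat_uniq; apply/and3P; split; first by case: ifP.
    apply/hasPn => t /allpairsPdep[js [f [hjs hf ->]]].
    case: ifP => // _; rewrite inE; apply/eqP => -[f0].
    move: hjs hf; rewrite wordsP mem_forests // f0.
    by case: js.
  apply: allpairs_uniq_dep.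
  - rewrite -[X in uniq X]map_id map_flatten -map_comp.
    apply: (@allpairs_uniq_dep _ _ _ (fun _ js => js) (iota 1 N) (words n)).
    + exact: iota_uniq.
    + by move=> m _; exact: words_uniq.
    move=> x y /allpairsPdep[k [t [_ ht ->]]] /allpairsPdep[l [u [_ hu ->]]] /= tu.
    by subst u; move: ht hu; rewrite !mem_words => /eqP <- /eqP <-.
  - by move=> js _; exact: forests_uniq.
  move=> x y /allpairsPdep[k [f [_ hf ->]]] /allpairsPdep[l [g [_ hg ->]]] /= [fg].
  by subst g; move: hf hg; rewrite !mem_forests // => /andP[/eqP <- _] /andP[/eqP <- _].
move=> [j f]; rewrite mem_cat /= eqSS; apply/orP/andP => [[]|].
- by case: ifP => // /eqP ->; rewrite inE => /eqP[-> ->] /=; rewrite eqxx.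
- move=> /allpairsPdep[js [g [_ hg [-> ->]]]].
  by move: hg; rewrite mem_forests // => /andP[_ ->].
move=> [/eqP -> fN]; case: f fN => [|t f] fN.
  by left; rewrite -(eqP fN) /= inE.
right; apply/allpairsPdep; exists (map (@rtype n) (t :: f)), (t :: f); split=> //.
  rewrite wordsP size_map /= -(eqP fN) /=.
  by rewrite -[(size f).+1]/(size (t :: f)); apply: (size_le_sumn_nverts (t :: f)).
by rewrite mem_forests // eqxx fN.
Qed.

Lemma mem_trees i N t : (t \in trees i N) = (rtype t == i) && (nverts t == N).
Proof. exact: (@trees_uptoP N i N (leqnn N)).2. Qed.

Lemma trees_uniq i N : uniq (trees i N).
Proof. exact: (@trees_uptoP N i N (leqnn N)).1. Qed.

Lemma perm_trees_upto d i N : (N <= d)%N -> perm_eq (trees_upto d i N) (trees i N).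
Proof.
move=> Nd; apply: uniq_perm; rewrite ?trees_uniq ?(@trees_uptoP d i N Nd).1 // => t.
by rewrite mem_trees (@trees_uptoP d i N Nd).2.
Qed.

Lemma mu_cont f : mu f = cont (map (@rtype n) f).
Proof. by apply/ffunP => k; rewrite !ffunE count_map. Qed.

End TreeEnumeration.

(** * Generating functions of trees *)

Section GeneratingFunctions.
Variables (R : realType) (n : nat) (H : 'I_n -> mi n -> R[i]).
Implicit Types (t : ntree n) (js : seq 'I_n).

(** The weight of an internal vertex of type i whose children have types js, from left to right. *)
Definition kappa i js : R[i] := H i (cont js) / (size js)`!%:R.

Lemma kappa1 i j : kappa i [:: j] = Amat H i j.
Proof.
rewrite /kappa mxE /= divr1; congr (H i _).
by apply/ffunP => k; rewrite !ffunE /= addn0 eq_sym.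
Qed.

(** The factor a! / |a|! carried by a word turns the Taylor coefficient H / a! of F into the tree
    weight H / |a|!. This is why planar trees come with |mu(v)|!. *)
Lemma hcoef_cont i js m : js \in words n m.+1 ->
  (mfact (cont js))%:R / m.+1`!%:R * hcoef H i (cont js) = kappa i js.
Proof.
rewrite mem_words => /eqP sjs; rewrite /hcoef /kappa ifF.
  rewrite sjs mulrC mulrA divfK // pnatr_eq0 -lt0n.
  by apply: prodn_gt0 => k; rewrite fact_gt0.
apply/eqP => /(congr1 (@msize n)); rewrite msize_cont sjs /msize big1 // => k _.
by rewrite ffunE.
Qed.

Lemma hcoef_nil i : hcoef H i (cont [::]) = 0.
Proof. by rewrite /hcoef ifT //; apply/eqP/ffunP => k; rewrite !ffunE. Qed.

Lemma psum_hcoef i z D : psum (hcoef H i) z D =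
  \sum_(m < D) \sum_(js <- words n m.+1) kappa i js * \prod_(j <- js) z j.
Proof.
rewrite /psum (sum_mi_words (fun a => hcoef H i a * mon a z)) big_ord_recl.
rewrite big_seq1 hcoef_nil mul0r mulr0 add0r; apply: eq_bigr => m _.
rewrite big_seq [RHS]big_seq; apply: eq_bigr => js jsm.
by rewrite mulrA (hcoef_cont i jsm) mon_cont.
Qed.

Lemma pabssum_hcoef i z D : pabssum (hcoef H i) z D =
  \sum_(m < D) \sum_(js <- words n m.+1) `|kappa i js * \prod_(j <- js) z j|.
Proof.
rewrite /pabssum (sum_mi_words (fun a => `|hcoef H i a * mon a z|)) big_ord_recl.
rewrite big_seq1 hcoef_nil mul0r normr0 mulr0 add0r; apply: eq_bigr => m _.
rewrite big_seq [RHS]big_seq; apply: eq_bigr => js jsm.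
rewrite -[X in X * _]ger0_norm ?divr_ge0 ?ler0n // -normrM mulrA.
by rewrite (hcoef_cont i jsm) mon_cont.
Qed.

(** * Tree sums with values in an arbitrary algebra *)

Section Algebra.
Variable L : algType R[i].
Implicit Types (p q : 'I_n -> nat -> L).

(** The coefficient of T^N in the product over j in js of the series with coefficients [p j k]. *)
Fixpoint cprod p js N : L :=
  if js is j :: js' then \sum_(k < N.+1) p j k * cprod p js' (N - k)%N
  else (N == 0%N)%:R.

Lemma eq_cprod p q js N : (forall j k, (k <= N)%N -> p j k = q j k) ->
  cprod p js N = cprod q js N.
Proof.
elim: js N => //= j js IH N pq; apply: eq_bigr => k _.
rewrite pq -1?ltnS // IH // => i l lN; apply: pq; apply: leq_trans lN _.
exact: leq_subr.
Qed.

Lemma cprod_eq0 p js N : (forall j, p j 0%N = 0) -> (N < size js)%N ->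
  cprod p js N = 0.
Proof.
move=> p0; elim: js N => //= j js IH N Njs; apply: big1 => k _.
case: (posnP k) => [->|k0]; first by rewrite p0 mul0r.
rewrite IH ?mulr0 //; case: N Njs k => [|N] Njs k in k0 *.
  by case: k k0 => -[].
by rewrite ltnS in Njs; apply: leq_trans Njs; rewrite ltn_subrL k0.
Qed.

Lemma cprod1 p j N : cprod p [:: j] N = p j N.
Proof.
rewrite /= big_ord_recr /= subnn eqxx mulr1 big1 ?add0r // => k _.
by rewrite subn_eq0 leqNgt ltn_ord mulr0.
Qed.

Variable y : 'I_n -> L.

(** Leaves of type j are evaluated at [y j]. The algebra [L] will be a polynomial ring, to control
    coefficients, and then the complex numbers, to control values. *)
Fixpoint tval t : L :=
  let: Node j cs := t in
  if cs is [::] then y j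
  else (H j (mu cs) / (size cs)`!%:R) *: \prod_(w <- map tval cs) w.

Definition gf i N : L := \sum_(t <- trees i N) tval t.

(** Vertex counts add up over a forest, so summing over forests distributes into a convolution of
    the tree sums. *)
Lemma sum_forests T js N : enumerates T N ->
  \sum_(f <- forests T js N) \prod_(t <- f) tval t =
  cprod (fun j k => \sum_(t <- T j k) tval t) js N.
Proof.
elim: js N => [|j js IH] N TN.
  by rewrite /=; case: eqP => _; rewrite ?big_seq1 ?big_nil.
rewrite -[forests _ _ _]/[seq t :: f | t <- flatten [seq T j k | k <- iota 0 N.+1],
  f <- forests T js (N - nverts t)%N].
rewrite big_allpairs_dep big_flatten big_map.
rewrite -[iota 0 N.+1]/(index_iota 0 N.+1) big_mkord.
rewrite [RHS]/=; apply: eq_bigr => k _.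
have kN : (k <= N)%N by rewrite -ltnS.
rewrite mulr_suml big_seq [RHS]big_seq; apply: eq_bigr => t.
rewrite (TN _ _ kN).2 => /andP[_ /eqP ->].
rewrite -IH; last by apply: enumeratesW TN; exact: leq_subr.
by rewrite mulr_sumr; apply: eq_bigr => f _; rewrite big_cons.
Qed.

Lemma gf0 i : gf i 0 = 0.
Proof. by rewrite /gf big_nil. Qed.

(** Cutting off the root: the tree is a single leaf, or its children form a forest with N vertices.
    Any cutoff D >= N on the length of words gives the same sum. *)
Lemma gfS i N D : (N <= D)%N -> gf i N.+1 =
  (if N == 0%N then y i else 0) +
  \sum_(m < D) \sum_(js <- words n m.+1) kappa i js *: cprod gf js N.
Proof.
move=> ND; rewrite /gf /trees [trees_upto _ _ _]/= big_cat /=; congr (_ + _).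
  by case: eqP => _; rewrite ?big_seq1 ?big_nil.
rewrite big_allpairs_dep big_flatten big_map.
rewrite (_ : iota 1 N = index_iota 1 N.+1); last by rewrite /index_iota subn1.
rewrite big_add1 /= -(subnKC ND) big_mkord [RHS]big_split_ord /=.
(* Words longer than N contribute zero, since every child needs a vertex. *)
rewrite [X in _ = _ + X]big1 ?addr0 => [|m _]; last first.
  rewrite big_seq; apply: big1 => js; rewrite mem_words => /eqP sjs.
  rewrite cprod_eq0 ?scaler0 // => [j|]; first exact: gf0.
  by rewrite sjs ltnS leq_addr.
apply: eq_bigr => m _; rewrite big_seq [RHS]big_seq; apply: eq_bigr => js.
rewrite mem_words => /eqP sjs.
transitivity (\sum_(f <- forests (trees_upto (n:=n) N) js N) kappa i js *: \prod_(t <- f) tval t).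
  rewrite big_seq [RHS]big_seq; apply: eq_bigr => f.
  rewrite mem_forests; last exact: trees_uptoP.
  move=> /andP[/eqP fjs _]; rewrite /= big_map mu_cont fjs /kappa.
  by rewrite -fjs size_map; case: f fjs => // fjs; rewrite -fjs in sjs.
rewrite -scaler_sumr sum_forests; last exact: trees_uptoP.
congr (_ *: _); apply: eq_cprod => j k kN; apply: perm_big.
exact: perm_trees_upto.
Qed.

End Algebra.

(** Trees are nested through lists, so the induction runs on the number of vertices, of which a
    child has strictly fewer. *)
Lemma ntree_nested_ind (P : ntree n -> Prop) :
  (forall j cs, {in cs, forall c, P c} -> P (Node j cs)) -> forall t, P t.
Proof.
move=> PN t; have [N] := ubnP (nverts t); elim: N t => // N IH [j cs] /= tN.
apply: PN => c ccs; apply: IH; rewrite ltnS in tN.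
apply: leq_trans tN; rewrite ltnS sumnE big_map (big_rem c) //=.
exact: leq_addr.
Qed.

(** Leaf vectors of the children add up and [E] turns sums into products. Used with [E] the formal
    monomial and with [E] its value at a point. *)
Lemma tval_monomial (L : algType R[i]) (E : mi n -> L) t :
  E mi0 = 1 -> (forall a b : mi n, E [ffun k => (a k + b k)%N] = E a * E b) ->
  tval (fun j => E (mie j)) t = tweight H t *: E (leafvec t).
Proof.
move=> E1 ED; elim/ntree_nested_ind: t => j [|c cs] IH; first by rewrite scale1r.
rewrite -[tval _ _]/((H j (mu (c :: cs)) / (size (c :: cs))`!%:R) *:
  \prod_(w <- map (tval (fun j => E (mie j))) (c :: cs)) w).
rewrite -[tweight _ _]/((H j (mu (c :: cs)) / (size (c :: cs))`!%:R) *
  \prod_(w <- map (tweight H) (c :: cs)) w).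
(* The leaf vector is rewritten as an iterated sum, so that additivity applies child by child. *)
have leafE ds : [ffun k => sumn (map (fun c => leafvec c k) ds)] =
    foldr (fun a b : mi n => [ffun k => (a k + b k)%N]) mi0 (map (@leafvec n) ds) :> mi n.
  elim: ds => [|d ds IHd] /=; apply/ffunP => k; rewrite !ffunE //=.
  by rewrite -IHd ffunE.
rewrite -[RHS]scalerA; congr (_ *: _); rewrite !big_map [leafvec _](leafE (c :: cs)).
elim: (c :: cs) IH => [|d ds IHd] IH; first by rewrite !big_nil E1 scale1r.
rewrite !big_cons /= ED IH ?mem_head // IHd => [|e de]; last first.
  by apply: IH; rewrite inE de orbT.
by rewrite -scalerAl -scalerAr scalerA.
Qed.

Lemma gblockE i a N :
  gblock H i a N = \sum_(t <- trees i N | leafvec t == a) tweight H t.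
Proof.
rewrite /gblock -[RHS]big_filter [RHS]fsbig_seq ?filter_uniq ?trees_uniq //.
apply: eq_fsbigl; apply/seteqP; split => t /=; rewrite mem_filter mem_trees.
  by move=> [<- [<- <-]]; rewrite !eqxx.
by move=> /andP[/eqP la /andP[/eqP ti /eqP tN]]; rewrite /Sset /= la ti tN.
Qed.

Lemma msize_leafvec t : (msize (leafvec t) <= nverts t)%N.
Proof.
elim/ntree_nested_ind: t => j [|c cs] IH.
  rewrite /msize (bigD1 j) //= ffunE eqxx big1 // => k /negbTE kj.
  by rewrite ffunE kj.
rewrite -[leafvec _]/[ffun k => sumn (map (fun c => leafvec c k) (c :: cs))].
rewrite -[nverts _]/(sumn (map (@nverts n) (c :: cs))).+1 /msize; apply: leqW.
under eq_bigr do rewrite ffunE.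
elim: (c :: cs) IH => [|d ds IHd] IH; first by rewrite big1.
rewrite /= big_split leq_add ?IH ?mem_head // IHd // => e de.
by apply: IH; rewrite inE de orbT.
Qed.

End GeneratingFunctions.

(** * Modulus and matrix norm *)

Section Modulus.
Local Open Scope complex_scope.
Local Open Scope ring_scope.
Variable R : realType.
Implicit Types z w : R[i].

(** The modulus as an element of R: the norm of [R[i]] has values in [R[i]], where real arithmetic
    is not directly available. *)
Definition cabs z : R := complex.Re `|z|.

Lemma normr_cabs z : `|z| = (cabs z)%:C.
Proof. by rewrite /cabs normc_def. Qed.

Lemma cabs_ge0 z : 0 <= cabs z.
Proof. by rewrite -lecR -normr_cabs normr_ge0. Qed.

Lemma cabs_real (x : R) : 0 <= x -> cabs x%:C = x.
Proof. by move=> x0; rewrite /cabs ger0_norm // lecR. Qed.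

Lemma cabs0 : cabs 0 = 0.
Proof. by rewrite /cabs normr0. Qed.

Lemma cabs1 : cabs 1 = 1.
Proof. by rewrite /cabs normr1. Qed.

Lemma cabsN z : cabs (- z) = cabs z.
Proof. by rewrite /cabs normrN. Qed.

Lemma cabs_eq0 z : cabs z <= 0 -> z = 0.
Proof.
move=> z0; apply/eqP; rewrite -normr_eq0 normr_cabs.
by have /eqP -> : cabs z == 0 by rewrite eq_le z0 cabs_ge0.
Qed.

Lemma cabsM z w : cabs (z * w) = cabs z * cabs w.
Proof. by apply: complexI; rewrite rmorphM /= -!normr_cabs normrM. Qed.

Lemma cabsD z w : cabs (z + w) <= cabs z + cabs w.
Proof. by rewrite -lecR rmorphD /= -!normr_cabs ler_normD. Qed.

Lemma cabs_sum I (r : seq I) (P : pred I) (F : I -> R[i]) :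
  cabs (\sum_(i <- r | P i) F i) <= \sum_(i <- r | P i) cabs (F i).
Proof.
elim/big_ind2: _ => [|x a y b xa yb|i _] //; first by rewrite cabs0.
exact: le_trans (cabsD _ _) (lerD xa yb).
Qed.

Lemma cabs_prod I (r : seq I) (F : I -> R[i]) :
  cabs (\prod_(i <- r) F i) = \prod_(i <- r) cabs (F i).
Proof. by apply: (big_morph _ cabsM cabs1). Qed.

Lemma normr_sum_cabs I (r : seq I) (P : pred I) (F : I -> R[i]) :
  \sum_(i <- r | P i) `|F i| = (\sum_(i <- r | P i) cabs (F i))%:C.
Proof. by rewrite rmorph_sum /=; apply: eq_bigr => i _; exact: normr_cabs. Qed.

Lemma pos_complex (r : R[i]) : 0 < r -> exists2 e : R, 0 < e & r = e%:C.
Proof.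
case: r => e d; rewrite ltcE /= => /andP[/eqP d0 e0].
by exists e => //; rewrite d0.
Qed.

Lemma cvg_cabs (u : nat -> R[i]) l : u @ \oo --> l <->
  forall e : R, 0 < e -> exists N, forall k, (N <= k)%N -> cabs (l - u k) < e.
Proof.
split=> [/cvgrPdist_lt ul e e0|ul].
  have e0' : 0 < (e%:C : R[i]) by rewrite ltcR.
  have [N _ uN] := ul _ e0'; exists N => k Nk.
  by have := uN k Nk; rewrite /= normr_cabs ltcR.
apply/cvgrPdist_lt => _ /pos_complex[e e0 ->].
have [N uN] := ul e e0; exists N => // k /= Nk.
by rewrite normr_cabs ltcR uN.
Qed.

Lemma cabs_cvg_le (u : nat -> R[i]) l B : u @ \oo --> l ->
  (exists N, forall k, (N <= k)%N -> cabs (u k) <= B) -> cabs l <= B.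
Proof.
move=> /cvg_cabs ul [N uB]; rewrite leNgt; apply/negP => Bl.
have e0 : 0 < cabs l - B by rewrite subr_gt0.
have [M uM] := ul _ e0.
have := uM _ (leq_maxl M N); have := uB _ (leq_maxr M N).
set k := maxn M N => h1 h2.
have := cabsD (l - u k) (u k); rewrite subrK; lra.
Qed.

Lemma cabs_cvgZ (u : nat -> R[i]) l c : u @ \oo --> l ->
  (fun k => c * u k) @ \oo --> c * l.
Proof.
move=> /cvg_cabs ul; apply/cvg_cabs => e e0.
have c1 : 0 < cabs c + 1 by rewrite ltr_wpDl // cabs_ge0.
have [N uN] := ul (e / (cabs c + 1)) (divr_gt0 e0 c1); exists N => k Nk.
have := uN k Nk; rewrite ltr_pdivlMr // -mulrBr cabsM.
by have := cabs_ge0 (l - u k); have := cabs_ge0 c; nra.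
Qed.

Lemma cabs_cvgD (u v : nat -> R[i]) l m : u @ \oo --> l -> v @ \oo --> m ->
  (fun k => u k + v k) @ \oo --> l + m.
Proof.
move=> /cvg_cabs ul /cvg_cabs vm; apply/cvg_cabs => e e0.
have e20 : 0 < e / 2 by rewrite divr_gt0.
have [N uN] := ul _ e20; have [M vM] := vm _ e20.
exists (maxn N M) => k; rewrite geq_max => /andP[/uN h1 /vM h2].
have := cabsD (l - u k) (m - v k); rewrite opprD addrACA; lra.
Qed.

Lemma real_cvg_complex (v : nat -> R) : cvgn v ->
  exists l : R[i], (fun N => (v N)%:C) @ \oo --> l.
Proof.
move=> /cvg_ex[l /cvgrPdist_lt vl]; exists l%:C; apply/cvg_cabs => e e0.
have [N _ vN] := vl e e0; exists N => k Nk; have := vN k Nk.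
by rewrite -rmorphB /= /cabs normc_def /= expr0n addr0 sqrtr_sqr.
Qed.

Lemma cabs_Re z : `|complex.Re z| <= cabs z.
Proof. by rewrite -lecR -normr_cabs; exact: normc_ge_Re. Qed.

(** Real and imaginary parts are dominated by the modulus, so both are absolutely convergent real
    series. *)
Lemma cabs_summable_cvg (u : nat -> R[i]) B :
  (forall N, \sum_(k < N) cabs (u k) <= B) ->
  exists l : R[i], (fun N => \sum_(k < N) u k) @ \oo --> l.
Proof.
move=> uB.
have cvgR (v : nat -> R) : (forall k, `|v k| <= cabs (u k)) ->
    cvgn (fun N => \sum_(k < N) v k).
  move=> vu; have : cvgn (series v).
    apply: normed_cvg; apply: nondecreasing_is_cvgn.
      by apply: nondecreasing_series => k _ _; exact: normr_ge0.
    exists B => _ [N _ <-]; rewrite /= /series /= big_mkord.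
    by apply: le_trans (uB N); apply: ler_sum.
  by rewrite /series; under eq_fun do rewrite big_mkord.
have [a ha] := real_cvg_complex (cvgR (fun k => complex.Re (u k)) (fun k => cabs_Re _)).
have Imu k : `|complex.Im (u k)| <= cabs (u k).
  rewrite -lecR -normr_cabs; case: (u k) => x z; rewrite normc_def lecR /=.
  by rewrite -sqrtr_sqr ler_wsqrtr // lerDr sqr_ge0.
have [b hb] := real_cvg_complex (cvgR (fun k => complex.Im (u k)) Imu).
exists (a + 'i%C * b).
have -> : (fun N => \sum_(k < N) u k) = (fun N =>
    (\sum_(k < N) complex.Re (u k))%:C +
    'i%C * (\sum_(k < N) complex.Im (u k))%:C).
  apply/funext => N; rewrite !rmorph_sum mulr_sumr -big_split /=.
  by apply: eq_bigr => k _; exact: complexE.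
exact: (cabs_cvgD ha (cabs_cvgZ hb)).
Qed.

End Modulus.

(** * Entrywise matrix norm and decay of the powers of A *)

Section MatrixNorm.
Variables (R : realType) (n : nat).
Implicit Types A B : 'M[R[i]]_n.

Definition mxabs A : R := \sum_i \sum_j cabs (A i j).

Lemma mxabs_ge0 A : 0 <= mxabs A.
Proof. by do 2![apply: sumr_ge0 => ? _]; exact: cabs_ge0. Qed.

Lemma mxabs_apply A (v : 'I_n -> R) : (forall j, 0 <= v j) ->
  \sum_i \sum_j cabs (A i j) * v j <= mxabs A * \sum_j v j.
Proof.
move=> v0; rewrite mulr_suml; apply: ler_sum => i _.
rewrite mulr_suml; apply: ler_sum => j _; apply: ler_wpM2l; first exact: cabs_ge0.
by rewrite (bigD1 j) //= lerDl sumr_ge0.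
Qed.

Lemma mxabsM A B : mxabs (A *m B) <= mxabs A * mxabs B.
Proof.
apply: (@le_trans _ _ (\sum_i \sum_k cabs (A i k) * \sum_j cabs (B k j))).
  apply: ler_sum => i _.
  apply: (@le_trans _ _ (\sum_j \sum_k cabs (A i k) * cabs (B k j))).
    apply: ler_sum => j _; rewrite mxE; apply: le_trans (cabs_sum _ _ _) _.
    by apply: ler_sum => k _; rewrite cabsM.
  by rewrite exchange_big /=; apply: ler_sum => k _; rewrite mulr_sumr.
apply: mxabs_apply => k; apply: sumr_ge0 => j _; exact: cabs_ge0.
Qed.

Lemma powers_small A : cvgn (fun N => \sum_(k < N) A ^+ k) ->
  forall e : R, 0 < e -> exists N, forall k, (N <= k)%N -> mxabs (A ^+ k) < e.
Proof.
move=> /cvg_ex[S AS].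
have entry i j (e : R) : 0 < e -> exists N, forall k, (N <= k)%N -> cabs ((A ^+ k) i j) < e.
  move=> e0.
  have : (fun N => (\sum_(k < N) A ^+ k) i j) @ \oo --> S i j.
    exact: (@continuous_cvg nat 'M[R[i]]_n (R[i]) \oo _ _ (fun M => M i j) S (@coord_continuous _ n n i j S) AS).
  have e20 : 0 < e / 2 by rewrite divr_gt0.
  move=> /cvg_cabs /(_ _ e20)[N uN]; exists N => k Nk.
  (* The power is the difference of two consecutive partial sums, both within e / 2 of the limit. *)
  have := uN _ Nk; have := uN _ (leqW Nk); rewrite big_ord_recr mxE /=.
  set a := (\sum_(k1 < k) A ^+ k1) i j; set b := (A ^+ k) i j => h1 h2.
  have -> : b = (S i j - a) + - (S i j - (a + b)) by ring.
  by have := cabsD (S i j - a) (- (S i j - (a + b))); rewrite cabsN; lra.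
(* There are n * n entries; the successor keeps [c] positive for n = 0 and makes the last inequality
   strict. *)
move=> e e0; pose c : R := (n * n).+1%:R.
have c0 : 0 < c by rewrite ltr0n.
have ec0 : 0 < e / c by rewrite divr_gt0.
have /choice[N hN] ij : exists N, forall k, (N <= k)%N -> cabs ((A ^+ k) ij.1 ij.2) < e / c.
  exact: entry.
exists (\max_(ij : 'I_n * 'I_n) N ij)%N => k Nk.
rewrite /mxabs pair_bigA /=.
apply: (@le_lt_trans _ _ (\sum_(ij : 'I_n * 'I_n) e / c)).
  apply: ler_sum => ij _; apply/ltW/hN; apply: leq_trans Nk.
  exact: leq_bigmax.
rewrite sumr_const card_prod !card_ord -mulr_natr -mulrA gtr_pMr // mulrC.
by rewrite ltr_pdivrMr // mul1r ltr_nat.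
Qed.

End MatrixNorm.

(** The sequence halves every k0 steps, while a tau close to 1 has tau^k0 <= 4/3; the weighted
    sequence still shrinks by 2/3 over each period. *)
Lemma geometric_weight (R : realType) (a : nat -> R) (k0 : nat) :
  (forall k, 0 <= a k) -> (0 < k0)%N -> (forall k, a (k + k0)%N <= a k / 2) ->
  exists tau B : R, [/\ 1 < tau, 0 <= B &
    forall D, \sum_(k < D) a k * tau ^+ k <= B].
Proof.
move=> a0 k0_gt0 ak.
have K0 : 0 < (k0%:R : R) by rewrite ltr0n.
have K1 : 1 <= (k0%:R : R) by rewrite ler1n.
(* This is 1 / tau; Bernoulli's inequality gives x^k0 >= 1 - 1/4. *)
pose x : R := 1 - (4 * k0%:R)^-1.
have d0 : 0 < (4 * k0%:R : R)^-1 by rewrite invr_gt0 mulr_gt0.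
have d1 : (4 * k0%:R : R)^-1 <= 4^-1.
  by rewrite lef_pV2 ?posrE ?mulr_gt0 // ler_peMr.
have x0 : 0 < x by rewrite /x; lra.
have x1 : x < 1 by rewrite /x; lra.
have bern m : 1 - m%:R * (4 * k0%:R)^-1 <= x ^+ m.
  elim: m => [|m IH]; first by rewrite mul0r subr0 expr0.
  rewrite exprSr -natr1; apply: le_trans (ler_wpM2r (ltW x0) IH).
  rewrite /x; set d := _^-1 in d0 *; have : 0 <= m%:R * d * d.
    by rewrite !mulr_ge0 // ltW.
  nra.
have xk0 : 3 / 4 <= x ^+ k0.
  apply: le_trans (bern k0); rewrite invfM mulrCA divff ?gt_eqF //; lra.
pose tau := x^-1.
have tau1 : 1 < tau by rewrite /tau invf_gt1.
have tau0 : 0 <= tau by rewrite ltW // (lt_trans ltr01).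
have tk0 : tau ^+ k0 <= 4 / 3.
  by rewrite exprVn -div1r ler_pdivrMr ?exprn_gt0 //; lra.
pose S D := \sum_(k < D) a k * tau ^+ k.
have S0 D : 0 <= S D by apply: sumr_ge0 => k _; rewrite mulr_ge0 // exprn_ge0.
(* From S(D) <= S(k0 + D) <= S(k0) + 2/3 S(D) follows S(D) <= 3 S(k0). *)
exists tau, (3 * S k0); split=> // [|D]; first by rewrite mulr_ge0.
have : S (k0 + D)%N <= S k0 + 2 / 3 * S D.
  rewrite /S big_split_ord /= lerD2l mulr_sumr; apply: ler_sum => k _.
  rewrite addnC exprD mulrA.
  have h : 0 <= tau ^+ k by rewrite exprn_ge0.
  have h' : 0 <= tau ^+ k0 by rewrite exprn_ge0.
  have := ak k; have := a0 k; have := a0 (k + k0)%N.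
  set u := a _; set v := a k => u0 v0 uv.
  have -> : u * tau ^+ k * tau ^+ k0 = tau ^+ k * (u * tau ^+ k0) by ring.
  have -> : 2 / 3 * (v * tau ^+ k) = tau ^+ k * (2 / 3 * v) by ring.
  apply: ler_wpM2l => //; nra.
have : S D <= S (k0 + D)%N.
  rewrite /S addnC big_split_ord /= lerDl; apply: sumr_ge0 => k _.
  by rewrite mulr_ge0 // exprn_ge0.
rewrite -/(S D); lra.
Qed.

(** One power of norm below 1/2 makes the norms halve periodically, by submultiplicativity. The
    period is N + 1 because it must be positive. *)
Lemma matrix_powers_decay (R : realType) (n : nat) (A : 'M[R[i]]_n) :
  cvgn (fun N => \sum_(k < N) A ^+ k) ->
  exists tau B : R, [/\ 1 < tau, 0 <= B &
    forall D, \sum_(k < D) mxabs (A ^+ k) * tau ^+ k <= B].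
Proof.
move=> /powers_small A0; have h2 : 0 < 2^-1 :> R by lra.
have [N AN] := A0 _ h2.
apply: (@geometric_weight R (fun k => mxabs (A ^+ k)) N.+1) => // k.
  exact: mxabs_ge0.
rewrite exprD; apply: le_trans (mxabsM _ _) _.
apply: ler_wpM2l; first exact: mxabs_ge0.
by rewrite ltW // AN.
Qed.

(** * The majorant *)

Lemma sum_triangle (V : nmodType) (F : nat -> nat -> V) D :
  \sum_(N < D) \sum_(k < N.+1) F k (N - k)%N =
  \sum_(k < D) \sum_(l < D - k) F k l.
Proof.
elim: D => [|D IH]; first by rewrite !big_ord0.
rewrite big_ord_recr IH [RHS]big_ord_recr /= subSnn big_ord1.
rewrite big_ord_recr /= subnn addrA -big_split /=; congr (_ + _).
by apply: eq_bigr => k _; rewrite subSn 1?ltnW // big_ord_recr.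
Qed.

(** The triangle k + l < D lies inside the square k, l < D. *)
Lemma sum_cauchy_le (R : realType) (a b : nat -> R) D :
  (forall k, 0 <= a k) -> (forall k, 0 <= b k) ->
  \sum_(N < D) \sum_(k < N.+1) a k * b (N - k)%N <=
  (\sum_(k < D) a k) * \sum_(k < D) b k.
Proof.
move=> a0 b0; rewrite (sum_triangle (fun k l => a k * b l)) mulr_suml.
apply: ler_sum => k _; rewrite -mulr_sumr; apply: ler_wpM2l => //.
have -> : \sum_(l < D) b l = \sum_(l < (D - k) + k) b l by rewrite subnK // ltnW.
by rewrite big_split_ord lerDl sumr_ge0.
Qed.

Section Majorant.
Variables (R : realType) (n : nat) (H : 'I_n -> mi n -> R[i]).

Definition kabs (js : seq 'I_n) : R := \sum_i cabs (kappa H i js).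
(** The degree m coefficient of a one-variable majorant common to all components of id - F. *)
Definition kweight m : R := \sum_(js <- words n m) kabs js.

Lemma kabs_ge0 js : 0 <= kabs js.
Proof. by apply: sumr_ge0 => i _; exact: cabs_ge0. Qed.

Lemma kweight_ge0 m : 0 <= kweight m.
Proof. by apply: sumr_ge0 => js _; exact: kabs_ge0. Qed.

Lemma cabs_kappa_le i js : cabs (kappa H i js) <= kabs js.
Proof.
rewrite /kabs (bigD1 i) //= lerDl; apply: sumr_ge0 => k _; exact: cabs_ge0.
Qed.

Variables (L : algType R[i]) (nu : L -> R).
Hypotheses (nu_ge0 : forall x, 0 <= nu x) (nu0 : nu 0 = 0) (nu1 : nu 1 <= 1).
Hypothesis nuD : forall x y, nu (x + y) <= nu x + nu y.
Hypothesis nuM : forall x y, nu (x * y) <= nu x * nu y.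
Hypothesis nuZ : forall c x, nu (c *: x) <= cabs c * nu x.

Lemma seminorm_sum I (r : seq I) (P : pred I) (F : I -> L) :
  nu (\sum_(i <- r | P i) F i) <= \sum_(i <- r | P i) nu (F i).
Proof.
elim/big_ind2: _ => [|x a y b xa yb|i _] //; first by rewrite nu0.
exact: le_trans (nuD _ _) (lerD xa yb).
Qed.

Variables (tau : R) (tau0 : 0 <= tau).

(** The weight tau^N is multiplicative along a convolution, so the weighted sums multiply like
    norms. *)
Lemma cprod_bound (p : 'I_n -> nat -> L) (s : R) js D :
  (forall j, \sum_(N < D) nu (p j N) * tau ^+ N <= s) ->
  \sum_(N < D) nu (cprod p js N) * tau ^+ N <= s ^+ size js.
Proof.
move=> ps; elim: js => [|j js IH] /=.
  case: D {ps} => [|D]; first by rewrite big_ord0.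
  rewrite big_ord_recl big1 => [|k _]; last by rewrite /= nu0 mul0r.
  by rewrite addr0 expr0 mulr1.
have t0 k : 0 <= tau ^+ k by exact: exprn_ge0.
have f0 (f : nat -> L) k : 0 <= nu (f k) * tau ^+ k by rewrite mulr_ge0.
rewrite exprS; apply: le_trans (ler_pM _ _ (ps j) IH); last 2 first.
- by apply: sumr_ge0 => k _; exact: (f0 (p j)).
- by apply: sumr_ge0 => k _; exact: (f0 (cprod p js)).
apply: le_trans (@sum_cauchy_le R (fun k => nu (p j k) * tau ^+ k)
  (fun k => nu (cprod p js k) * tau ^+ k) D (f0 _) (f0 _)).
apply: ler_sum => N _.
apply: le_trans (ler_wpM2r (t0 N) (seminorm_sum _ _ _)) _.
rewrite mulr_suml; apply: ler_sum => k _; rewrite mulrACA -exprD subnKC; last first.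
  by rewrite -ltnS.
exact: ler_wpM2r.
Qed.

Variable y : 'I_n -> L.
Let p := gf H y.
Let A := Amat H.
(** Contribution of roots with at least two children. Words of length up to N + 1 suffice in
    [gfS]. *)
Let q i N : L := \sum_(m < N) \sum_(js <- words n m.+2) kappa H i js *: cprod p js N.

Lemma gf_rec i N : p i N.+1 =
  (if N == 0%N then y i else 0) + \sum_j A i j *: p j N + q i N.
Proof.
rewrite /p (gfS H y i (leqnSn N)) big_ord_recl addrA; congr (_ + _ + _).
rewrite sum_wordsS; apply: eq_bigr => j _.
by rewrite big_seq1 kappa1 cprod1.
Qed.

Lemma pow0_apply (v : 'I_n -> L) i : \sum_j (A ^+ 0) i j *: v j = v i.
Proof.
rewrite expr0 (bigD1 i) //= mxE eqxx scale1r big1 ?addr0 // => j ji.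
by rewrite mxE eq_sym (negbTE ji) scale0r.
Qed.

Lemma powS_apply m (v : 'I_n -> L) i :
  \sum_j A i j *: (\sum_k (A ^+ m) j k *: v k) = \sum_k (A ^+ m.+1) i k *: v k.
Proof.
transitivity (\sum_j \sum_k (A i j * (A ^+ m) j k) *: v k).
  apply: eq_bigr => j _; rewrite scaler_sumr; apply: eq_bigr => k _.
  by rewrite scalerA.
rewrite exchange_big /=; apply: eq_bigr => k _.
by rewrite exprS mxE scaler_suml.
Qed.

(* Unary vertices contribute the linear part A; solving for it leaves only
   products of at least two factors, weighted by powers of A. *)
Lemma gf_duhamel N i : p i N.+1 =
  \sum_j (A ^+ N) i j *: y j +
  \sum_(k < N.+1) \sum_j (A ^+ (N - k)) i j *: q j k.
Proof.
elim: N i => [|N IH] i.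
  rewrite gf_rec big_ord1 subnn !pow0_apply /= big1 ?addr0 // => j _.
  by rewrite /p gf0 scaler0.
rewrite gf_rec add0r [X in _ = _ + X]big_ord_recr /= subnn pow0_apply addrA.
congr (_ + _); rewrite -powS_apply.
transitivity (\sum_j (A i j *: (\sum_k (A ^+ N) j k *: y k) +
    A i j *: (\sum_(k < N.+1) \sum_l (A ^+ (N - k)) j l *: q l k))).
  by apply: eq_bigr => j _; rewrite IH scalerDr.
rewrite big_split /=; congr (_ + _).
transitivity (\sum_j \sum_(k < N.+1)
    A i j *: (\sum_l (A ^+ (N - k)) j l *: q l k)).
  by apply: eq_bigr => j _; rewrite scaler_sumr.
rewrite exchange_big /=; apply: eq_bigr => k _.
by rewrite (powS_apply (N - k) (fun l => q l k)) subSn // -ltnS.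
Qed.

Variables (B s1 M s0 : R).
Hypothesis powA : forall D, \sum_(k < D) mxabs (A ^+ k) * tau ^+ k <= B.
Hypotheses (s1_gt0 : 0 < s1) (s0_ge0 : 0 <= s0) (s01 : s0 <= s1).
Hypothesis kM : forall D, \sum_(m < D) kweight m.+1 * s1 ^+ m.+1 <= M.
Hypothesis small : tau * B * (\sum_j nu (y j) + (s0 / s1) ^+ 2 * M) <= s0.

(** Shrinking the radius from s1 to s0 gains at least (s0 / s1)^2 on terms of degree at least
    two. *)
Lemma kweight2_le D :
  \sum_(m < D) kweight m.+2 * s0 ^+ m.+2 <= (s0 / s1) ^+ 2 * M.
Proof.
have s1_ge0 := ltW s1_gt0.
have r0 : 0 <= s0 / s1 by rewrite divr_ge0 // ltW.
have r1 : s0 / s1 <= 1 by rewrite ler_pdivrMr // mul1r.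
apply: le_trans (ler_wpM2l (exprn_ge0 2 r0) (kM D.+1)).
rewrite big_ord_recl mulrDr ler_wpDl //.
  by apply: mulr_ge0; [exact: exprn_ge0 | rewrite mulr_ge0 ?kweight_ge0 ?exprn_ge0].
rewrite mulr_sumr; apply: ler_sum => m _.
rewrite [leRHS]mulrCA; apply: ler_wpM2l; first exact: kweight_ge0.
have -> : s0 ^+ m.+2 = (s0 / s1) ^+ m.+2 * s1 ^+ m.+2.
  by rewrite -exprMn divfK // gt_eqF.
apply: ler_wpM2r; first by rewrite exprn_ge0 // ltW.
by rewrite -addn2 exprD ler_piMl ?exprn_ge0 // exprn_ile1.
Qed.

(** A bootstrap on D. The vanishing p(0) and the shift in [gf_duhamel] make p below D + 1 depend
    only on q below D, hence on p below D, already bounded by s0; [small] says that the resulting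
    bound is again at most s0. *)
Lemma gf_bound D : \sum_j \sum_(N < D) nu (p j N) * tau ^+ N <= s0.
Proof.
have t0 k : 0 <= tau ^+ k by exact: exprn_ge0.
elim: D => [|D IH]; first by rewrite big1 // => j _; rewrite big_ord0.
have IHj j : \sum_(N < D) nu (p j N) * tau ^+ N <= s0.
  apply: le_trans IH; rewrite (bigD1 j) //= lerDl.
  by do 2![apply: sumr_ge0 => ? _]; rewrite mulr_ge0.
apply: le_trans small.
have B0 : 0 <= B by apply: le_trans (powA 0); rewrite big_ord0.
pose Q k := \sum_j nu (q j k).
have Q0 k : 0 <= Q k by apply: sumr_ge0.
have Qle : \sum_(k < D) tau ^+ k * Q k <= (s0 / s1) ^+ 2 * M.
  apply: le_trans (kweight2_le D).
  apply: (@le_trans _ _ (\sum_(k < D) \sum_(m < D) \sum_(js <- words n m.+2)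
     kabs js * (nu (cprod p js k) * tau ^+ k))).
    apply: ler_sum => k _.
    apply: (@le_trans _ _ (\sum_(m < k) \sum_(js <- words n m.+2)
       kabs js * (nu (cprod p js k) * tau ^+ k))).
      rewrite mulr_sumr.
      apply: (@le_trans _ _ (\sum_j \sum_(m < k) \sum_(js <- words n m.+2)
          cabs (kappa H j js) * (nu (cprod p js k) * tau ^+ k))).
        apply: ler_sum => j _; rewrite mulrC.
        apply: le_trans (ler_wpM2r (t0 _) (seminorm_sum _ _ _)) _.
        rewrite mulr_suml; apply: ler_sum => m _.
        apply: le_trans (ler_wpM2r (t0 _) (seminorm_sum _ _ _)) _.
        rewrite mulr_suml; apply: ler_sum => js _; rewrite mulrA.
        exact: ler_wpM2r.
      rewrite exchange_big /=; apply: ler_sum => m _.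
      rewrite exchange_big /=; apply: ler_sum => js _.
      by rewrite -mulr_suml.
    (* The terms are nonnegative, so the range of m is enlarged from k to D and the sums become
       exchangeable. *)
    have -> : \sum_(m < D) \sum_(js <- words n m.+2) kabs js * (nu (cprod p js k) * tau ^+ k)
      = \sum_(m < k + (D - k)) \sum_(js <- words n m.+2) kabs js * (nu (cprod p js k) * tau ^+ k).
      by rewrite subnKC // ltnW.
    rewrite big_split_ord /= lerDl; do 2![apply: sumr_ge0 => ? _].
    by rewrite !mulr_ge0 // kabs_ge0.
  rewrite exchange_big /=; apply: ler_sum => m _.
  rewrite exchange_big /= /kweight mulr_suml big_seq [leRHS]big_seq.
  apply: ler_sum => js; rewrite mem_words => /eqP <-.
  rewrite -mulr_sumr; apply: ler_wpM2l; first exact: kabs_ge0.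
  exact: cprod_bound.
pose Y := \sum_j nu (y j).
have Y0 : 0 <= Y by apply: sumr_ge0.
have step N : \sum_j nu (p j N.+1) <= mxabs (A ^+ N) * Y +
    \sum_(k < N.+1) mxabs (A ^+ (N - k)) * Q k.
  apply: (@le_trans _ _ (\sum_i (\sum_j cabs ((A ^+ N) i j) * nu (y j) +
     \sum_(k < N.+1) \sum_j cabs ((A ^+ (N - k)) i j) * nu (q j k)))).
    apply: ler_sum => i _; rewrite gf_duhamel.
    apply: le_trans (nuD _ _) (lerD _ _).
      by apply: le_trans (seminorm_sum _ _ _) (ler_sum _ _) => j _.
    apply: le_trans (seminorm_sum _ _ _) (ler_sum _ _) => k _.
    by apply: le_trans (seminorm_sum _ _ _) (ler_sum _ _) => j _.
  rewrite big_split /= lerD //; first exact: mxabs_apply.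
  by rewrite exchange_big /=; apply: ler_sum => k _; apply: mxabs_apply.
rewrite exchange_big big_ord_recl /= big1 ?add0r; last first.
  by move=> j _; rewrite /p gf0 nu0 mul0r.
(* The root adds one vertex, which costs the factor tau. *)
have -> : \sum_(N < D) \sum_j nu (p j (bump 0 N)) * tau ^+ bump 0 N =
    tau * \sum_(N < D) (\sum_j nu (p j N.+1)) * tau ^+ N.
  rewrite mulr_sumr; apply: eq_bigr => N _; rewrite mulr_suml mulr_sumr.
  by apply: eq_bigr => j _; rewrite /bump /= add1n exprS mulrCA.
rewrite -mulrA; apply: ler_wpM2l => //.
(* Writing tau^N as tau^k tau^(N-k) exhibits a convolution of two weighted sequences. *)
apply: (@le_trans _ _ (\sum_(N < D) (mxabs (A ^+ N) * tau ^+ N * Y +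
   \sum_(k < N.+1) (tau ^+ k * Q k) * (mxabs (A ^+ (N - k)) * tau ^+ (N - k))))).
  apply: ler_sum => N _; apply: le_trans (ler_wpM2r (t0 N) (step N)) _.
  rewrite mulrDl mulrAC lerD2l mulr_suml; apply: ler_sum => k _.
  have -> : tau ^+ N = tau ^+ k * tau ^+ (N - k).
    by rewrite -exprD subnKC // -ltnS.
  move: (tau ^+ k) (tau ^+ (N - k)) => a b.
  by rewrite le_eqVlt; apply/orP; left; apply/eqP; ring.
rewrite big_split /= mulrDr lerD //.
  by rewrite -mulr_suml; apply: ler_wpM2r => //; exact: powA.
have tQ0 k : 0 <= tau ^+ k * Q k by rewrite mulr_ge0.
have tA0 k : 0 <= mxabs (A ^+ k) * tau ^+ k by rewrite mulr_ge0 // mxabs_ge0.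
apply: le_trans (sum_cauchy_le D tQ0 tA0) _.
by rewrite mulrC; apply: ler_pM => //; apply: sumr_ge0.
Qed.

End Majorant.

(** * The l1 norm on polynomials *)

Lemma mon_mie (A : comPzRingType) n (y : 'I_n -> A) j : mon (mie j) y = y j.
Proof.
rewrite /mon (bigD1 j) //= ffunE eqxx expr1 big1 ?mulr1 // => k /negbTE kj.
by rewrite ffunE kj expr0.
Qed.

Lemma msize_mie n (j : 'I_n) : msize (mie j) = 1%N.
Proof.
rewrite /msize (bigD1 j) //= ffunE eqxx big1 // => k /negbTE kj.
by rewrite ffunE kj.
Qed.

Section PolynomialNorm.
Import -(notations) mpoly.
Variables (R : realType) (n : nat) (rho : R).
Hypothesis rho0 : 0 <= rho.
Local Notation L := (mpoly n R[i]).
Implicit Types (p q : L) (S : seq (multinom n)).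

(** The coefficient norm at radius rho. Unlike the value at a point, it controls all coefficients at
    once, without cancellation. *)
Definition l1norm p : R :=
  \sum_(m <- msupp p) cabs (mcoeff m p) * rho ^+ mdeg m.

Let term_ge0 p m : 0 <= cabs (mcoeff m p) * rho ^+ mdeg m.
Proof. by rewrite mulr_ge0 ?cabs_ge0 ?exprn_ge0. Qed.

Let sum_msupp p S : uniq S ->
  \sum_(m <- S) cabs (mcoeff m p) * rho ^+ mdeg m =
  \sum_(m <- [seq m <- msupp p | m \in S]) cabs (mcoeff m p) * rho ^+ mdeg m.
Proof.
move=> uS; rewrite (bigID (mem (msupp p))) /= addrC big1 ?add0r => [|m mp].
  rewrite -big_filter; apply/perm_big/uniq_perm.
  - exact: filter_uniq.
  - by rewrite filter_uniq ?msupp_uniq.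
  by move=> m; rewrite !mem_filter andbC.
by rewrite memN_msupp_eq0 // cabs0 mul0r.
Qed.

Lemma le_l1norm p S : uniq S ->
  \sum_(m <- S) cabs (mcoeff m p) * rho ^+ mdeg m <= l1norm p.
Proof.
move=> uS; rewrite sum_msupp // big_filter /l1norm.
by rewrite [leRHS](bigID (fun m => m \in S)) /= lerDl sumr_ge0.
Qed.

Lemma l1normE p S : uniq S -> {subset msupp p <= S} ->
  l1norm p = \sum_(m <- S) cabs (mcoeff m p) * rho ^+ mdeg m.
Proof.
move=> uS pS; rewrite sum_msupp // /l1norm; congr bigop.
by apply/esym/all_filterP/allP.
Qed.

Lemma l1norm_ge0 p : 0 <= l1norm p.
Proof. by apply: sumr_ge0 => m _; exact: term_ge0. Qed.

Lemma l1norm0 : l1norm 0 = 0.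
Proof. by rewrite /l1norm big1 // => m _; rewrite mcoeff0 cabs0 mul0r. Qed.

Lemma l1normD p q : l1norm (p + q) <= l1norm p + l1norm q.
Proof.
pose S := undup (msupp p ++ msupp q ++ msupp (p + q)).
have uS : uniq S by exact: undup_uniq.
rewrite !(@l1normE _ S) //; try by move=> m mp; rewrite mem_undup !mem_cat mp ?orbT.
rewrite -big_split; apply: ler_sum => m _; rewrite /= -mulrDl mcoeffD.
by apply: ler_wpM2r (cabsD _ _); exact: exprn_ge0.
Qed.

Lemma l1normZ c p : l1norm (c *: p) <= cabs c * l1norm p.
Proof.
rewrite (@l1normE _ (msupp p)) ?msupp_uniq //; last exact: msuppZ_le.
rewrite /l1norm mulr_sumr; apply: ler_sum => m _.
by rewrite mcoeffZ cabsM mulrA.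
Qed.

Lemma l1normX m : l1norm (mpolyX R[i] m) = rho ^+ mdeg m.
Proof. by rewrite /l1norm msuppX big_seq1 mcoeffX eqxx cabs1 mul1r. Qed.

Lemma l1norm1 : l1norm 1 <= 1.
Proof.
rewrite -[1 in X in X <= _](mpolyX0 n R[i]) l1normX.
by rewrite mdeg0 expr0.
Qed.

(** Expanding into monomials, the weight rho^deg is multiplicative; collecting equal monomials only
    lowers the norm. *)
Lemma l1normM p q : l1norm (p * q) <= l1norm p * l1norm q.
Proof.
rewrite mpolyME; apply: le_trans (seminorm_sum l1norm0 l1normD _ _ _) _.
rewrite big_allpairs /= /l1norm mulr_suml; apply: ler_sum => m _.
rewrite mulr_sumr; apply: ler_sum => k _; apply: le_trans (l1normZ _ _) _.
by rewrite l1normX mdegD exprD cabsM mulrACA.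
Qed.

Definition mnm_of (a : mi n) : multinom n := Multinom [tuple a i | i < n].

Lemma mnm_of_inj : injective mnm_of.
Proof.
move=> a b ab; apply/ffunP => k.
by rewrite -(mnmE a k) -/(mnm_of a) ab mnmE.
Qed.

Lemma mdeg_mnm_of a : mdeg (mnm_of a) = Defs.msize a.
Proof. by rewrite mdegE; apply: eq_bigr => k _; rewrite mnmE. Qed.

Variable H : 'I_n -> mi n -> R[i].

(** Trees evaluated at the variables themselves, so that the coefficients are the blocks of g. *)
Definition gpoly := gf H (fun j => mpolyX R[i] (mnm_of (mie j)) : L).

Lemma mcoeff_gpoly i N a : mcoeff (mnm_of a) (gpoly i N) = gblock H i a N.
Proof.
rewrite /gpoly /gf gblockE raddf_sum [RHS]big_mkcond /=; apply: eq_bigr => t _.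
rewrite (@tval_monomial _ _ _ _ (fun a => mpolyX R[i] (mnm_of a) : L)).
- rewrite mcoeffZ mcoeffX (inj_eq mnm_of_inj).
  by case: eqP => _; rewrite ?mulr1 ?mulr0.
- rewrite -[RHS](mpolyX0 n R[i]); congr mpolyX; apply/mnmP => k.
  by rewrite mnmE mnm0E ffunE.
move=> b c; rewrite -mpolyXD; congr mpolyX; apply/mnmP => k.
by rewrite mnmDE !mnmE ffunE.
Qed.

Lemma gblock_le_l1norm i N K :
  \sum_(b : {ffun 'I_n -> 'I_K.+1})
     cabs (gblock H i (mi_of b) N) * rho ^+ Defs.msize (mi_of b) <=
  l1norm (gpoly i N).
Proof.
apply: le_trans (@le_l1norm _ [seq mnm_of (mi_of b) | b : {ffun 'I_n -> 'I_K.+1}] _).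
  rewrite big_map big_enum /=; apply: ler_sum => b _.
  by rewrite mcoeff_gpoly mdeg_mnm_of.
rewrite map_inj_uniq ?enum_uniq //.
exact: inj_comp mnm_of_inj (@mi_of_inj n K).
Qed.

Lemma gpoly_bound (tau B s1 M s0 : R) D :
  0 <= tau -> (forall D, \sum_(k < D) mxabs (Amat H ^+ k) * tau ^+ k <= B) ->
  0 < s1 -> 0 <= s0 -> s0 <= s1 ->
  (forall D, \sum_(m < D) kweight H m.+1 * s1 ^+ m.+1 <= M) ->
  tau * B * (n%:R * rho + (s0 / s1) ^+ 2 * M) <= s0 ->
  \sum_j \sum_(N < D) l1norm (gpoly j N) * tau ^+ N <= s0.
Proof.
move=> tau0 powA s1_gt0 s0_ge0 s01 kM small.
apply: (gf_bound l1norm_ge0 l1norm0 l1norm1 l1normD l1normM l1normZ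
  tau0 powA s1_gt0 s0_ge0 s01 kM).
under eq_bigr do rewrite l1normX mdeg_mnm_of msize_mie expr1.
by rewrite sumr_const card_ord -[_ *+ _]mulr_natl.
Qed.

End PolynomialNorm.

(** * Convergence and the inverse *)

(** A finite sum passes to the limit: one index k serves all summands. *)
Lemma sum_cabs_cvg_le (R : realType) (I : finType) (u : I -> nat -> R[i])
    (l : I -> R[i]) (c : I -> R) (X : R) N0 :
  (forall b, 0 <= c b) -> (forall b, u b @ \oo --> l b) ->
  (forall k, (N0 <= k)%N -> \sum_b cabs (u b k) * c b <= X) ->
  \sum_b cabs (l b) * c b <= X.
Proof.
move=> c0 ul uX; apply/ler_addgt0Pr => e e0.
(* Adding 1 keeps the divisor positive when all weights vanish. *)
pose s := \sum_b c b + 1.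
have s_gt0 : 0 < s by rewrite ltr_wpDl // sumr_ge0.
have /choice[N hN] b : exists N, forall k, (N <= k)%N -> cabs (l b - u b k) < e / s.
  by apply: (cvg_cabs _ _).1 => //; rewrite divr_gt0.
pose k := maxn N0 (\max_b N b)%N.
have := uX k (leq_maxl _ _).
suff : \sum_b cabs (l b) * c b <= \sum_b cabs (u b k) * c b + e by lra.
apply: (@le_trans _ _ (\sum_b (cabs (u b k) * c b + e / s * c b))).
  apply: ler_sum => b _; rewrite -mulrDl; apply: ler_wpM2r => //.
  have := hN b k (leq_trans (leq_bigmax b) (leq_maxr _ _)).
  by have := cabsD (l b - u b k) (u b k); rewrite subrK; lra.
rewrite big_split lerD2l /= -mulr_sumr mulrAC ler_pdivrMr //.
by rewrite ler_pM2l // /s lerDl.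
Qed.

Lemma geometric_small (R : realType) (tau c e : R) : 1 < tau -> 0 < e ->
  exists N, forall k, (N <= k)%N -> c / tau ^+ k < e.
Proof.
move=> t1 e0; have t0 : 0 < tau by apply: lt_trans t1.
have /cvgrPdist_lt/(_ (e / (`|c| + 1))) : tau^-1 ^+ k @[k --> \oo] --> (0 : R).
  by apply: cvg_expr; rewrite ger0_norm ?invr_ge0 ?ltW // invf_lt1.
have c1 : 0 < `|c| + 1 by rewrite ltr_wpDl.
case=> [|N _ hN]; first by rewrite divr_gt0.
exists N => k Nk; have := hN k Nk; rewrite /= sub0r normrN exprVn.
have tk : 0 < (tau ^+ k)^-1 by rewrite invr_gt0 exprn_gt0.
rewrite gtr0_norm // ltr_pdivlMr // => h.
have := ler_norm c; nra.
Qed.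

Lemma cabsX (R : realType) (z : R[i]) k : cabs (z ^+ k) = cabs z ^+ k.
Proof. by elim: k => [|k IH]; rewrite ?expr0 ?cabs1 // !exprS cabsM IH. Qed.

Lemma cabs_mon_le (R : realType) n (y : 'I_n -> R[i]) (rho : R) (a : mi n) :
  (forall j, cabs (y j) <= rho) -> cabs (mon a y) <= rho ^+ msize a.
Proof.
move=> yr; rewrite /mon /msize expr_sum cabs_prod; apply: ler_prod => k _.
by rewrite cabs_ge0 cabsX lerXn2r ?nnegrE ?cabs_ge0 // (le_trans (cabs_ge0 (y k))).
Qed.

Lemma cvg_succ (R : realType) (u : nat -> R[i]) (l : R[i]) :
  u @ \oo --> l -> (fun N => u N.+1) @ \oo --> l.
Proof.
move=> /cvg_cabs ul; apply/cvg_cabs => e /ul[N uN]; exists N => k Nk.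
exact/uN/leqW.
Qed.

(** Grouping words by length turns the sum over multi-indices into an ordinary absolutely convergent
    series. *)
Lemma psum_cvg (R : realType) n (c : mi n -> R[i]) (z : 'I_n -> R[i]) (M : R) :
  (forall N, pabssum c z N <= real_complex R M) ->
  exists l : R[i], psum c z N @[N --> \oo] --> l.
Proof.
move=> cM.
pose w js : R[i] := (mfact (cont js))%:R / (size js)`!%:R * (c (cont js) * mon (cont js) z).
have [N|l hl] := @cabs_summable_cvg R (fun m => \sum_(js <- words n m) w js) M.
  apply: (@le_trans _ _ (\sum_(m < N.+1) \sum_(js <- words n m) cabs (w js))).
    rewrite big_ord_recr /= ler_wpDr //.
      by apply: sumr_ge0 => js _; exact: cabs_ge0.
    by apply: ler_sum => m _; exact: cabs_sum.
  rewrite -lecR; apply: le_trans (cM N).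
  rewrite /pabssum (sum_mi_words (fun a => `|c a * mon a z|)) rmorph_sum.
  apply: ler_sum => m _; rewrite /= -normr_sum_cabs big_seq [leRHS]big_seq.
  apply: ler_sum => js; rewrite mem_words => /eqP sjs; rewrite /w sjs normrM.
  by rewrite ger0_norm // divr_ge0.
exists l; have -> : psum c z = (fun N => \sum_(m < N.+1) \sum_(js <- words n m) w js).
  apply/funext => N; rewrite /psum (sum_mi_words (fun a => c a * mon a z)).
  apply: eq_bigr => m _; rewrite big_seq [RHS]big_seq; apply: eq_bigr => js.
  by rewrite mem_words => /eqP sjs; rewrite /w sjs.
exact: (cvg_succ hl).
Qed.

Section PowerSeriesBounds.
Variables (R : realType) (n : nat) (H : 'I_n -> mi n -> R[i]) (s1 M : R).
Hypothesis s1_ge0 : 0 <= s1.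
Hypothesis kM : forall D, \sum_(m < D) kweight H m.+1 * s1 ^+ m.+1 <= M.

Lemma prod_cabs_le (x : 'I_n -> R[i]) s js : (forall j, cabs (x j) <= s) ->
  cabs (\prod_(j <- js) x j) <= s ^+ size js.
Proof. by move=> xs; rewrite -mon_cont -(msize_cont js); exact: cabs_mon_le. Qed.

Lemma pabssum_hcoef_le (x : 'I_n -> R[i]) i N : (forall j, cabs (x j) <= s1) ->
  pabssum (hcoef H i) x N <= real_complex R M.
Proof.
move=> xs; rewrite pabssum_hcoef; under eq_bigr do rewrite normr_sum_cabs.
rewrite -(rmorph_sum (real_complex R)) lecR; apply: le_trans (kM N).
apply: ler_sum => m _; rewrite /kweight mulr_suml big_seq [leRHS]big_seq.
apply: ler_sum => js; rewrite mem_words => /eqP <-; rewrite cabsM.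
by apply: ler_pM; rewrite ?cabs_ge0 ?cabs_kappa_le ?prod_cabs_le.
Qed.

End PowerSeriesBounds.

(** * Convergence of the coefficients and of the inverse series *)

Section Inverse.
Variables (R : realType) (n : nat) (H : 'I_n -> mi n -> R[i]).
Variables (tau B s1 M s0 rho : R).
Hypothesis tau1 : 1 < tau.
Hypothesis powA :
  forall D, \sum_(k < D) mxabs (Amat H ^+ k) * tau ^+ k <= B.
Hypotheses (s1_gt0 : 0 < s1) (s0_gt0 : 0 < s0) (s01 : 2 * s0 <= s1).
Hypothesis kM : forall D, \sum_(m < D) kweight H m.+1 * s1 ^+ m.+1 <= M.
Hypothesis rho_gt0 : 0 < rho.
Hypothesis small : tau * B * (n%:R * rho + (s0 / s1) ^+ 2 * M) <= s0.

Let tau0 : 0 < tau. Proof. exact: lt_trans tau1. Qed.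
Let t0 k : 0 <= tau ^+ k. Proof. by rewrite exprn_ge0 // ltW. Qed.
Let tgt0 k : 0 < tau ^+ k. Proof. by rewrite exprn_gt0. Qed.
Let t1 k : 1 <= tau ^+ k. Proof. by rewrite exprn_ege1 // ltW. Qed.
Let s0_le : s0 <= s1. Proof. by move: s0_gt0 s01; lra. Qed.
Let s0_ge0 : 0 <= s0. Proof. exact: ltW. Qed.
Let rho_ge0 : 0 <= rho. Proof. exact: ltW. Qed.
Let B_ge0 : 0 <= B. Proof. by have := powA 0; rewrite big_ord0. Qed.

Let sumj (F : 'I_n -> R) j D : (forall i, 0 <= F i) -> \sum_i F i <= D -> F j <= D.
Proof. by move=> F0; apply: le_trans; rewrite (bigD1 j) //= lerDl sumr_ge0. Qed.

(** Mass at radius rho of the block with N vertices on the box of multi-indices with entries at most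
    K; the bounds are uniform in K. *)
Let bnorm i N K : R := \sum_(b : {ffun 'I_n -> 'I_K.+1})
  cabs (gblock H i (mi_of b) N) * rho ^+ msize (mi_of b).

Let bnorm_ge0 i N K : 0 <= bnorm i N K.
Proof. by apply: sumr_ge0 => b _; rewrite mulr_ge0 ?cabs_ge0 ?exprn_ge0. Qed.

Lemma block_bound i K D : \sum_(N < D) bnorm i N K * tau ^+ N <= s0.
Proof.
apply: (@le_trans _ _ (\sum_(N < D) l1norm rho (gpoly H i N) * tau ^+ N)).
  apply: ler_sum => N _; apply: ler_wpM2r => //.
  exact: gblock_le_l1norm.
apply: (@sumj (fun j => \sum_(N < D) l1norm rho (gpoly H j N) * tau ^+ N)).
  by move=> j; apply: sumr_ge0 => N _; rewrite mulr_ge0 // l1norm_ge0.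
apply: (gpoly_bound rho_ge0 _ (ltW tau0) powA s1_gt0 s0_ge0 s0_le kM small).
Qed.

(** A single coefficient times rho^|a| is part of [bnorm], and tau^N >= 1, so the blocks are
    absolutely summable in N. *)
Lemma gpartial_cvg i a :
  exists l : R[i], gpartial H i a N @[N --> \oo] --> l.
Proof.
apply: (@cabs_summable_cvg _ _ (s0 / rho ^+ msize a)) => D.
rewrite ler_pdivlMr ?exprn_gt0 //.
apply: le_trans (block_bound i (msize a) D).
rewrite mulr_suml; apply: ler_sum => N _.
have [b ba] := mi_of_exists (leqnn (msize a)).
apply: (@le_trans _ _ (bnorm i N (msize a))).
  rewrite /bnorm (bigD1 b) //= ba lerDl; apply: sumr_ge0 => c _.
  by rewrite mulr_ge0 ?cabs_ge0 ?exprn_ge0.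
by rewrite ler_peMr.
Qed.

Variable g : 'I_n -> mi n -> R[i].
Hypothesis gcvg : forall i a, gpartial H i a N @[N --> \oo] --> g i a.

(** Blocks with N >= D carry a weight of at least tau^D in [block_bound]; dividing by it bounds the
    tail. *)
Lemma coef_tail i K D : \sum_(b : {ffun 'I_n -> 'I_K.+1})
  cabs (g i (mi_of b) - gpartial H i (mi_of b) D) * rho ^+ msize (mi_of b)
  <= s0 / tau ^+ D.
Proof.
apply: (@sum_cabs_cvg_le _ _ (fun b N => gpartial H i (mi_of b) N -
    gpartial H i (mi_of b) D)
  (fun b => g i (mi_of b) - gpartial H i (mi_of b) D)
  (fun b => rho ^+ msize (mi_of b)) _ D).
- by move=> b; rewrite exprn_ge0.
- move=> b; apply: (@cabs_cvgD _ (fun N => gpartial H i (mi_of b) N)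
    (fun=> - gpartial H i (mi_of b) D)); first exact: gcvg.
  exact: cvg_cst.
move=> N /subnKC <-; rewrite ler_pdivlMr //.
apply: le_trans (block_bound i K (D + (N - D))).
rewrite big_split_ord /= ler_wpDl //.
  by apply: sumr_ge0 => k _; rewrite mulr_ge0.
rewrite mulr_suml.
apply: (@le_trans _ _ (\sum_(b : {ffun 'I_n -> 'I_K.+1}) \sum_(k < N - D)
    cabs (gblock H i (mi_of b) (D + k)) * rho ^+ msize (mi_of b) * tau ^+ D)).
  apply: ler_sum => b _; rewrite /gpartial big_split_ord /= addrAC subrr add0r.
  rewrite -!mulr_suml; do 2![apply: ler_wpM2r => //]; first exact: exprn_ge0.
  exact: cabs_sum.
rewrite exchange_big /=; apply: ler_sum => k _; rewrite -mulr_suml.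
apply: ler_wpM2l; first exact: bnorm_ge0.
by rewrite exprD ler_peMr.
Qed.

Section Evaluation.
Variable y : 'I_n -> R[i].
Hypothesis yrho : forall j, cabs (y j) <= rho.

(** Here [mon (mie j) y] is just [y j], in the form that [tval_monomial] expects; [R[i]^o] is C as
    an algebra over itself. *)
Let p : 'I_n -> nat -> R[i] := gf H (fun j => mon (mie j) y : R[i]^o).
Let P i D := \sum_(N < D) p i N.

Lemma eval_bound i D : \sum_(N < D) cabs (p i N) * tau ^+ N <= s0.
Proof.
apply: (@sumj (fun j => \sum_(N < D) cabs (p j N) * tau ^+ N)).
  by move=> j; apply: sumr_ge0 => N _; rewrite mulr_ge0 // cabs_ge0.
have cabsM' (u v : R[i]) : cabs (u * v) <= cabs u * cabs v by rewrite cabsM.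
have cabs1' : cabs (1 : R[i]) <= 1 by rewrite cabs1.
apply: (@gf_bound R n H (R[i]^o : algType _) (@cabs R) (@cabs_ge0 R) (cabs0 R)
  cabs1' (@cabsD R) cabsM' cabsM' tau (ltW tau0) _ B s1 M s0 powA s1_gt0 s0_ge0
  s0_le kM).
apply: le_trans small; apply: ler_wpM2l; first by rewrite mulr_ge0 // ltW.
rewrite lerD2r mulr_natl -[n in leRHS]card_ord -sumr_const.
by apply: ler_sum => j _; rewrite mon_mie.
Qed.

Lemma evalE i N : p i N = \sum_(t <- trees i N) tweight H t * mon (leafvec t) y.
Proof.
apply: eq_bigr => t _.
rewrite (@tval_monomial _ _ _ (R[i]^o : algType _) (fun a => mon a y)) //.
  by rewrite /mon big1 // => k _; rewrite ffunE.
move=> a b; rewrite /mon -big_split; apply: eq_bigr => k _.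
by rewrite ffunE exprD.
Qed.

Lemma psum_gpartial i D K : (D <= K)%N ->
  psum (fun a => gpartial H i a D) y K = P i D.
Proof.
move=> DK; rewrite /psum /P.
transitivity (\sum_(b : {ffun 'I_n -> 'I_K.+1} | (\sum_(k < n) (b k : nat) <= K)%N)
    \sum_(N < D) \sum_(t <- trees i N) (leafvec t == mi_of b)%:R *
        (tweight H t * mon (leafvec t) y)).
  apply: eq_bigr => b _; rewrite mulr_suml; apply: eq_bigr => N _.
  rewrite gblockE big_mkcond mulr_suml; apply: eq_bigr => t _.
  by case: eqP => [->|_]; rewrite ?mul1r ?mul0r.
rewrite exchange_big /=; apply: eq_bigr => N _.
rewrite exchange_big /= evalE big_seq [RHS]big_seq; apply: eq_bigr => t.
rewrite mem_trees => /andP[_ /eqP tN].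
(* Trees with fewer than D vertices have degree below D <= K, so the truncation at degree K loses
   none of them. *)
have tK : (msize (leafvec t) <= K)%N.
  apply: leq_trans (msize_leafvec t) _; rewrite tN; apply: leq_trans DK.
  exact: ltnW.
have [b bt] := mi_of_exists tK.
rewrite (bigD1 b) /=; last by rewrite -msize_mi_of bt.
rewrite bt eqxx mul1r big1 ?addr0 // => c /andP[_ cb].
by rewrite -bt (inj_eq (@mi_of_inj n K)) eq_sym (negbTE cb) mul0r.
Qed.

Lemma psum_tail i D K :
  cabs (psum (g i) y K - psum (fun a => gpartial H i a D) y K) <= s0 / tau ^+ D.
Proof.
apply: le_trans (coef_tail i K D).
rewrite /psum -sumrB; apply: le_trans (cabs_sum _ _ _) _.
rewrite [leRHS](bigID (fun b : {ffun 'I_n -> 'I_K.+1} => (\sum_(k < n) (b k : nat) <= K)%N)) /=.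
rewrite ler_wpDr //; first by apply: sumr_ge0 => b _; rewrite mulr_ge0 ?cabs_ge0 ?exprn_ge0.
apply: ler_sum => b _; rewrite -mulrBl cabsM.
by apply: ler_wpM2l; [exact: cabs_ge0 | exact: cabs_mon_le].
Qed.

Lemma pabssum_g i K : exists2 c : R, pabssum (g i) y K = real_complex R c & c <= s0.
Proof.
rewrite /pabssum normr_sum_cabs; eexists; first by [].
(* At D = 0 the subtracted partial sum is empty and g itself is bounded. *)
have := coef_tail i K 0; rewrite expr0 divr1; apply: le_trans.
rewrite [leRHS](bigID (fun b : {ffun 'I_n -> 'I_K.+1} => (\sum_(k < n) (b k : nat) <= K)%N)) /=.
rewrite ler_wpDr //; first by apply: sumr_ge0 => b _; rewrite mulr_ge0 ?cabs_ge0 ?exprn_ge0.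
apply: ler_sum => b _; rewrite cabsM /gpartial big_ord0 subr0.
by apply: ler_wpM2l; [exact: cabs_ge0 | exact: cabs_mon_le].
Qed.

Section Solution.
Variable x : 'I_n -> R[i].
Hypothesis xcvg : forall i, psum (g i) y N @[N --> \oo] --> x i.

Lemma x_tail i D : cabs (x i - P i D) <= s0 / tau ^+ D.
Proof.
apply: (@cabs_cvg_le _ (fun K => psum (g i) y K - P i D)).
  apply: (@cabs_cvgD _ (psum (g i) y) (fun=> - P i D)); first exact: xcvg.
  exact: cvg_cst.
by exists D => K DK; rewrite -(psum_gpartial i DK); exact: psum_tail.
Qed.

Lemma x_bound i : cabs (x i) <= s0.
Proof. by have := x_tail i 0; rewrite /P big_ord0 subr0 expr0 divr1. Qed.

(** Splitting off one factor leaves two errors: the tail of that factor times the remaining product,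
    and its terms times the tail of the remaining product. Each is at most s0 times the bound for
    the rest, whence 2 s0 per letter. *)
Lemma prod_tail js D :
  cabs (\prod_(j <- js) x j - \sum_(N < D) cprod (L := R[i]^o) p js N) <=
  (2 * s0) ^+ size js / tau ^+ D.
Proof.
elim: js D => [|j js IH] D.
  rewrite big_nil /= expr0 div1r; case: D => [|D].
    by rewrite big_ord0 subr0 cabs1 expr0 invr1.
  rewrite big_ord_recl big1 ?addr0 ?subrr ?cabs0 ?invr_ge0 //.
pose q N : R[i] := cprod (L := R[i]^o) p js N.
rewrite big_cons /=; set X := \prod_(_ <- _) _.
have -> : \sum_(N < D) \sum_(k < N.+1) p j k * cprod (L := R[i]^o) p js (N - k)%N =
    \sum_(k < D) p j k * \sum_(l < D - k) q l.
  rewrite (sum_triangle (fun k l => p j k * q l)); apply: eq_bigr => k _.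
  by rewrite mulr_sumr.
have -> : x j * X - \sum_(k < D) p j k * \sum_(l < D - k) q l =
    (x j - P j D) * X + \sum_(k < D) p j k * (X - \sum_(l < D - k) q l).
  have -> : \sum_(k < D) p j k * (X - \sum_(l < D - k) q l) =
      P j D * X - \sum_(k < D) p j k * \sum_(l < D - k) q l.
    by rewrite /P mulr_suml -sumrB; apply: eq_bigr => k _; rewrite mulrBr.
  by ring.
apply: le_trans (cabsD _ _) _; set S := (2 * s0) ^+ size js.
have S0 : 0 <= S by rewrite exprn_ge0 // mulr_ge0.
have XS : cabs X <= S.
  apply: le_trans (prod_cabs_le js x_bound) _.
  by rewrite lerXn2r ?nnegrE ?mulr_ge0 // ler_peMl // ler1n.
have h1 : cabs ((x j - P j D) * X) <= s0 / tau ^+ D * S.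
  by rewrite cabsM; apply: ler_pM; rewrite ?cabs_ge0 ?x_tail.
have h2 : cabs (\sum_(k < D) p j k * (X - \sum_(l < D - k) q l)) <= s0 / tau ^+ D * S.
  apply: le_trans (cabs_sum _ _ _) _.
  (* The remaining product is truncated at D - k only; the missing tau^k is supplied by the weight
     in [eval_bound]. *)
  apply: (@le_trans _ _ (\sum_(k < D) cabs (p j k) * tau ^+ k * (S / tau ^+ D))).
    apply: ler_sum => k _; rewrite cabsM -mulrA; apply: ler_wpM2l; first exact: cabs_ge0.
    apply: le_trans (IH (D - k)%N) _; rewrite mulrCA -/S; apply: ler_wpM2l => //.
    have e : tau ^+ D = tau ^+ k * tau ^+ (D - k) by rewrite -exprD subnKC // ltnW.
    by rewrite e invfM mulrA divff ?mul1r // gt_eqF.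
  rewrite -mulr_suml [leRHS]mulrAC -[leRHS]mulrA.
  apply: ler_wpM2r; first by rewrite divr_ge0.
  exact: eval_bound.
rewrite exprS -/S.
have -> : 2 * s0 * S / tau ^+ D = s0 / tau ^+ D * S + s0 / tau ^+ D * S by ring.
exact: lerD.
Qed.

(** Summing the root recursion over N expresses the partial sum of x as y plus truncated products.
    By [prod_tail] a word costs (2 s0)^length <= s1^length, so the total error is at most (s0 + M) /
    tau^(D+1). *)
Lemma hcoef_cvg i : psum (hcoef H i) x N @[N --> \oo] --> x i - y i.
Proof.
have key D : cabs (x i - y i - psum (hcoef H i) x D.+1) <= (s0 + M) / tau ^+ D.+1.
  (* The term N = 0 vanishes, and words of length at most D + 1 suffice for every remaining N. *)
  have PE : P i D.+2 = y i + \sum_(m < D.+1) \sum_(js <- words n m.+1)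
      kappa H i js * \sum_(N < D.+1) cprod (L := R[i]^o) p js N.
    rewrite /P big_ord_recl /= [p i 0]gf0 add0r.
    transitivity (\sum_(N < D.+1) ((if N == 0%N :> nat then y i else 0) +
       \sum_(m < D.+1) \sum_(js <- words n m.+1)
         kappa H i js * cprod (L := R[i]^o) p js N)).
      apply: eq_bigr => N _; rewrite /p (gfS H _ i (ltnW (ltn_ord N))).
      by rewrite mon_mie.
    rewrite big_split /= big_ord_recl /= big1 // addr0; congr (_ + _).
    rewrite exchange_big /=; apply: eq_bigr => m _.
    rewrite exchange_big /=; apply: eq_bigr => js _; exact/esym/mulr_sumr.
  have -> : x i - y i - psum (hcoef H i) x D.+1 =
      (x i - P i D.+2) - \sum_(m < D.+1) \sum_(js <- words n m.+1) kappa H i js *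
         (\prod_(j <- js) x j - \sum_(N < D.+1) cprod (L := R[i]^o) p js N).
    rewrite PE psum_hcoef.
    have -> : \sum_(m < D.+1) \sum_(js <- words n m.+1) kappa H i js *
         (\prod_(j <- js) x j - \sum_(N < D.+1) cprod (L := R[i]^o) p js N) =
        \sum_(m < D.+1) \sum_(js <- words n m.+1) kappa H i js * \prod_(j <- js) x j -
        \sum_(m < D.+1) \sum_(js <- words n m.+1)
          kappa H i js * \sum_(N < D.+1) cprod (L := R[i]^o) p js N.
      rewrite -sumrB; apply: eq_bigr => m _; rewrite -sumrB; apply: eq_bigr => js _.
      by rewrite mulrBr.
    by ring.
  apply: le_trans (cabsD _ _) _; rewrite cabsN mulrDl; apply: lerD.
    apply: le_trans (x_tail _ _) _; apply: ler_wpM2l => //.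
    by rewrite lef_pV2 ?posrE // [leRHS]exprS ler_peMl // ltW.
  apply: (@le_trans _ _ (\sum_(m < D.+1) kweight H m.+1 * s1 ^+ m.+1 / tau ^+ D.+1)).
    apply: le_trans (cabs_sum _ _ _) (ler_sum _ _) => m _.
    rewrite /kweight -mulrA mulr_suml big_seq [leRHS]big_seq.
    apply: le_trans (cabs_sum _ _ _) (ler_sum _ _) => js.
    rewrite mem_words => /eqP sjs; rewrite cabsM.
    apply: ler_pM; rewrite ?cabs_ge0 ?cabs_kappa_le //.
    apply: le_trans (prod_tail _ _) _; rewrite sjs; apply: ler_wpM2r.
      by rewrite invr_ge0.
    by rewrite lerXn2r ?nnegrE ?mulr_ge0 // ltW.
  rewrite -mulr_suml; apply: ler_wpM2r; first by rewrite invr_ge0.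
  exact: kM.
apply/cvg_cabs => e e0; have [N hN] := geometric_small (s0 + M) tau1 e0.
exists N.+1 => -[//|k] Nk; apply: le_lt_trans (key k) _; apply: hN.
exact: ltnW.
Qed.

Lemma Fval_solution : Fval H x y.
Proof.
move=> i; exists (x i - y i); split; last by rewrite subKr.
split; last exact: hcoef_cvg.
exists (real_complex R M) => N; apply: (@pabssum_hcoef_le _ _ _ s1) => //.
  by move=> j; apply: le_trans (x_bound j) s0_le.
Qed.

End Solution.

Lemma inverse_exists : exists x : 'I_n -> R[i],
  [/\ forall i, ps_val (g i) y (x i), Fval H x y & forall i, cabs (x i) <= s0].
Proof.
have gs0 i N : pabssum (g i) y N <= real_complex R s0.
  by have [c -> cs] := pabssum_g i N; rewrite lecR.
have /choice[x xcvg] i := psum_cvg (gs0 i).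
exists x; split; first by move=> i; split; [exists (real_complex R s0) | exact: xcvg].
  exact: Fval_solution.
exact: x_bound.
Qed.

End Evaluation.
End Inverse.

(** * Injectivity near 0 *)

(** At the diagonal point with all coordinates s > 0, absolute convergence of every component is
    convergence of the majorant. *)
Lemma kweight_summable (R : realType) n (H : 'I_n -> mi n -> R[i]) :
  (exists2 r : R[i], 0 < r & forall x : 'I_n -> R[i], polydisc r x ->
     forall i, exists v, ps_val (hcoef H i) x v) ->
  exists s M : R, 0 < s /\ forall D, \sum_(m < D) kweight H m.+1 * s ^+ m.+1 <= M.
Proof.
case=> _ /pos_complex[e e0 ->] conv; pose s := e / 2.
have s0 : 0 < s by rewrite divr_gt0.
have sx : polydisc (real_complex R e) (fun _ : 'I_n => real_complex R s).
  by move=> k; rewrite normr_cabs ltcR cabs_real ?ltW // /s; lra.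
have /choice[M hM] i : exists M : R[i], forall N,
    pabssum (hcoef H i) (fun=> real_complex R s) N <= M.
  by have [v [[M hM] _]] := conv _ sx i; exists M.
exists s, (\sum_i complex.Re (M i)); split=> // D.
apply: (@le_trans _ _ (\sum_i \sum_(m < D) \sum_(js <- words n m.+1)
    cabs (kappa H i js) * s ^+ m.+1)).
  rewrite exchange_big /=; apply: ler_sum => m _.
  by rewrite exchange_big /= /kweight mulr_suml; apply: ler_sum => js _; rewrite mulr_suml.
apply: ler_sum => i _; have := hM i D; rewrite pabssum_hcoef.
have -> : \sum_(m < D) \sum_(js <- words n m.+1)
      `|kappa H i js * \prod_(j <- js) real_complex R s| =
    real_complex R (\sum_(m < D) \sum_(js <- words n m.+1)
      cabs (kappa H i js) * s ^+ m.+1).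
  rewrite rmorph_sum; apply: eq_bigr => m _; rewrite normr_sum_cabs.
  congr (real_complex R _); rewrite big_seq [RHS]big_seq; apply: eq_bigr => js.
  rewrite mem_words => /eqP <-; rewrite cabsM cabs_prod; congr (_ * _).
  rewrite cabs_real ?ltW //.
  by elim: js => [|j js IH]; rewrite ?big_nil ?big_cons ?expr0 //= exprS IH.
by rewrite lecE => /andP[_].
Qed.

(** Telescoping, one letter at a time; the bound is the derivative of s^m times d. *)
Lemma prod_diff_le (R : realType) n (x z : 'I_n -> R[i]) (s d : R) js :
  0 <= s -> (forall j, cabs (x j) <= s) -> (forall j, cabs (z j) <= s) ->
  (forall j, cabs (x j - z j) <= d) ->
  cabs (\prod_(j <- js) x j - \prod_(j <- js) z j) <=
  (size js)%:R * s ^+ (size js).-1 * d.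
Proof.
move=> s0 xs zs xzd; elim: js => [|j js IH].
  by rewrite !big_nil subrr cabs0 !mul0r.
rewrite !big_cons; set X := \prod_(_ <- _) x _; set Z := \prod_(_ <- _) z _.
have -> : x j * X - z j * Z = (x j - z j) * X + z j * (X - Z) by ring.
apply: le_trans (cabsD _ _) _; rewrite !cabsM /=.
have h1 : cabs (x j - z j) * cabs X <= d * s ^+ size js.
  by apply: ler_pM; rewrite ?cabs_ge0 ?prod_cabs_le.
have h2 : cabs (z j) * cabs (X - Z) <= s * ((size js)%:R * s ^+ (size js).-1 * d).
  by apply: ler_pM; rewrite ?cabs_ge0.
apply: le_trans (lerD h1 h2) _.
have -> : s * ((size js)%:R * s ^+ (size js).-1 * d) = (size js)%:R * (s ^+ size js * d).
  by case: (size js) => [|m]; rewrite ?mul0r ?mulr0 //= exprS; ring.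
by rewrite -natr1 le_eqVlt; apply/orP; left; apply/eqP; ring.
Qed.

Section Injectivity.
Variables (R : realType) (n : nat) (H : 'I_n -> mi n -> R[i]).
Variables (B s1 M s0 : R).
Hypotheses (s1_gt0 : 0 < s1) (s0_ge0 : 0 <= s0) (s01 : 2 * s0 <= s1).
Hypothesis kM : forall D, \sum_(m < D) kweight H m.+1 * s1 ^+ m.+1 <= M.
Let A := Amat H.

Lemma kweight_deriv_le D :
  \sum_(m < D) kweight H m.+2 * (m.+2%:R * s0 ^+ m.+1) <= 2 * s0 * M / s1 ^+ 2.
Proof.
have := kM D.+1; rewrite big_ord_recl /= => kM'.
have k0 : 0 <= kweight H 1 * s1 ^+ 1 by rewrite mulr_ge0 ?kweight_ge0 ?exprn_ge0 // ltW.
apply: (@le_trans _ _ (2 * s0 / s1 ^+ 2 * \sum_(m < D) kweight H m.+2 * s1 ^+ m.+2)).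
  rewrite mulr_sumr; apply: ler_sum => m _.
  rewrite [leRHS]mulrCA; apply: ler_wpM2l; first exact: kweight_ge0.
  have -> : 2 * s0 / s1 ^+ 2 * s1 ^+ m.+2 = 2 * s0 * s1 ^+ m.
    by rewrite -(addn2 m) exprD mulrAC mulrA mulfK // expf_neq0 // gt_eqF.
  rewrite exprS mulrCA [leRHS]mulrAC [leRHS]mulrC; apply: ler_wpM2l => //.
  (* The induction uses 2 s0 <= s1: the factor m + 2 grows by at most a factor 2 per step. *)
  elim: (m : nat) => [|k IH]; first by rewrite !expr0.
  rewrite -natr1 mulrDl mul1r.
  have e0 : 0 <= s0 ^+ k by exact: exprn_ge0.
  have n1 : 1 <= (k.+2%:R : R) by rewrite ler1n.
  rewrite [s0 ^+ k.+1]exprS [s1 ^+ k.+1]exprS.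
  have h1 : s0 * s0 ^+ k <= s0 * (k.+2%:R * s0 ^+ k).
    by apply: ler_wpM2l => //; rewrite ler_peMl.
  have h2 : 2 * s0 * (k.+2%:R * s0 ^+ k) <= s1 * (s1 ^+ k * 2).
    by rewrite [s1 ^+ k * 2]mulrC; apply: ler_pM; rewrite ?mulr_ge0.
  move: h1 h2; set a := k.+2%:R; set b := s0 ^+ k; nra.
rewrite [leRHS]mulrAC; apply: ler_wpM2l; last by move: kM' k0; rewrite /bump /=; lra.
by rewrite divr_ge0 ?mulr_ge0 ?exprn_ge0 // ltW.
Qed.

Hypothesis powA : forall D, \sum_(k < D) mxabs (A ^+ k) <= B.
Hypothesis small : B * (2 * s0 * M / s1 ^+ 2) <= 1 / 2.
Hypothesis A_small : exists N, mxabs (A ^+ N) < 1 / 4.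
Variables (x z v w : 'I_n -> R[i]).
Hypotheses (xs : forall j, cabs (x j) <= s0) (zs : forall j, cabs (z j) <= s0).
Hypothesis xv : forall i, psum (hcoef H i) x N @[N --> \oo] --> v i.
Hypothesis zw : forall i, psum (hcoef H i) z N @[N --> \oo] --> w i.
Hypothesis F_eq : forall i, x i - v i = z i - w i.

Let d i := x i - z i.
Let delta : R := \sum_i cabs (d i).
Let rest i := d i - \sum_j A i j * d j.

Let delta_ge0 : 0 <= delta.
Proof. by apply: sumr_ge0 => i _; exact: cabs_ge0. Qed.

(** Since F(x) = F(z), d is the difference of id - F at the two points. Subtracting A d removes the
    words of length one, and longer words are Lipschitz with a constant of order s0. *)
Lemma rest_le : \sum_i cabs (rest i) <= 2 * s0 * M / s1 ^+ 2 * delta.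
Proof.
pose u i D : R[i] := psum (hcoef H i) x D + (- psum (hcoef H i) z D - \sum_j A i j * d j).
have -> : \sum_i cabs (rest i) = \sum_i cabs (rest i) * 1.
  by apply: eq_bigr => i _; rewrite mulr1.
(* The start at 1 matters: the partial sum of degree 0 has no linear part to cancel A d. *)
apply: (@sum_cabs_cvg_le _ _ u rest (fun=> 1) _ 1%N); first by [].
  move=> i; have -> : rest i = v i + (- w i - \sum_j A i j * d j).
    rewrite /rest {1}/d; have := F_eq i => /(congr1 (fun c => c + v i - z i)) e.
    have -> : x i - z i = v i - w i by move: e; rewrite subrK => ->; ring.
    by ring.
  apply: (@cabs_cvgD _ (psum (hcoef H i) x) (fun D => - psum (hcoef H i) z D -
     \sum_j A i j * d j)); first exact: xv.
  apply: (@cabs_cvgD _ (fun D => - psum (hcoef H i) z D)); last exact: cvg_cst.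
  have := cabs_cvgZ (c := -1) (zw (i := i)); rewrite mulN1r.
  by under eq_fun do rewrite mulN1r.
case=> [//|D] _; apply: le_trans (_ : (\sum_(m < D) kweight H m.+2 * (m.+2%:R * s0 ^+ m.+1)) * delta <= _).
  apply: (@le_trans _ _ (\sum_i \sum_(m < D) \sum_(js <- words n m.+2)
      cabs (kappa H i js) * (m.+2%:R * s0 ^+ m.+1 * delta))).
    apply: ler_sum => i _; rewrite mulr1.
    have -> : u i D.+1 = \sum_(m < D) \sum_(js <- words n m.+2)
        kappa H i js * (\prod_(j <- js) x j - \prod_(j <- js) z j).
      rewrite /u !psum_hcoef !big_ord_recl /= !sum_wordsS.
      have lin (f : 'I_n -> R[i]) : \sum_j \sum_(js <- words n 0)
          kappa H i (j :: js) * \prod_(k <- j :: js) f k = \sum_j A i j * f j.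
        by apply: eq_bigr => j _; rewrite big_seq1 big_seq1 kappa1.
      rewrite !lin.
      have -> : \sum_j A i j * d j = \sum_j A i j * x j - \sum_j A i j * z j.
        by rewrite -sumrB; apply: eq_bigr => j _; rewrite mulrBr.
      have -> : \sum_(m < D) \sum_(js <- words n m.+2)
          kappa H i js * (\prod_(j <- js) x j - \prod_(j <- js) z j) =
          \sum_(m < D) \sum_(js <- words n m.+2) kappa H i js * \prod_(j <- js) x j -
          \sum_(m < D) \sum_(js <- words n m.+2) kappa H i js * \prod_(j <- js) z j.
        rewrite -sumrB; apply: eq_bigr => m _; rewrite -sumrB; apply: eq_bigr => js _.
        by rewrite mulrBr.
      rewrite /bump /=; ring.
    apply: le_trans (cabs_sum _ _ _) (ler_sum _ _) => m _.
    rewrite big_seq [leRHS]big_seq.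
    apply: le_trans (cabs_sum _ _ _) (ler_sum _ _) => js.
    rewrite mem_words => /eqP sjs; rewrite cabsM; apply: ler_wpM2l; first exact: cabs_ge0.
    have := @prod_diff_le R n x z s0 delta js s0_ge0 xs zs; rewrite sjs; apply=> j.
    rewrite /delta (bigD1 j) //= lerDl; apply: sumr_ge0 => k _; exact: cabs_ge0.
  rewrite exchange_big mulr_suml /=; apply: ler_sum => m _.
  rewrite exchange_big /= /kweight -[leRHS]mulrA [leRHS]mulr_suml; apply: ler_sum => js _.
  by rewrite mulr_suml.
by apply: ler_wpM2r => //; exact: kweight_deriv_le.
Qed.

(** Iterating d = A d + rest gives d = A^N d + sum of A^k rest over k < N. The two parts have norm
    at most 1/4 and 1/2 of that of d, so d = 0. *)
Lemma F_injective i : x i = z i.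
Proof.
have iter N : \col_j d j = A ^+ N *m \col_j d j + \sum_(k < N) A ^+ k *m \col_j rest j.
  elim: N => [|N IH]; first by rewrite big_ord0 addr0 expr0 mul1mx.
  rewrite [LHS]IH big_ord_recr /= addrA addrAC; congr (_ + _).
  rewrite exprSr -mulmxA -mulmxDr; congr (_ *m _).
  apply/colP => j; rewrite mxE mxE [in X in _ + X]mxE mxE.
  rewrite (eq_bigr (fun k => A j k * d k)); first by rewrite /rest addrC subrK.
  by move=> k _; rewrite [X in _ * X]mxE.
have [N AN] := A_small.
have dle : delta <= mxabs (A ^+ N) * delta + B * \sum_j cabs (rest j).
  apply: (@le_trans _ _ (\sum_i (\sum_j cabs ((A ^+ N) i j) * cabs (d j) +
      \sum_(k < N) \sum_j cabs ((A ^+ k) i j) * cabs (rest j)))).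
    apply: ler_sum => j _.
    have -> : d j = \sum_k (A ^+ N) j k * d k + \sum_(k < N) \sum_l (A ^+ k) j l * rest l.
      have := congr1 (fun C : 'cV[R[i]]_n => C j 0) (iter N).
      rewrite !mxE summxE => ->; congr (_ + _); first by apply: eq_bigr => k _; rewrite mxE.
      by apply: eq_bigr => k _; rewrite mxE; apply: eq_bigr => l _; rewrite mxE.
    apply: le_trans (cabsD _ _) (lerD _ _).
      by apply: le_trans (cabs_sum _ _ _) (ler_sum _ _) => k _; rewrite cabsM.
    apply: le_trans (cabs_sum _ _ _) (ler_sum _ _) => k _.
    by apply: le_trans (cabs_sum _ _ _) (ler_sum _ _) => l _; rewrite cabsM.
  rewrite big_split /=; apply: lerD.
    by apply: mxabs_apply => j; exact: cabs_ge0.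
  apply: (@le_trans _ _ ((\sum_(k < N) mxabs (A ^+ k)) * \sum_j cabs (rest j))).
    rewrite exchange_big mulr_suml /=; apply: ler_sum => k _.
    by apply: mxabs_apply => j; exact: cabs_ge0.
  by apply: ler_wpM2r => //; apply: sumr_ge0 => j _; exact: cabs_ge0.
have B0 : 0 <= B by have := powA 0; rewrite big_ord0.
have h1 : B * \sum_j cabs (rest j) <= 1 / 2 * delta.
  apply: le_trans (ler_wpM2l B0 rest_le) _.
  by rewrite mulrA; apply: ler_wpM2r.
have h2 : mxabs (A ^+ N) * delta <= 1 / 4 * delta.
  by apply: ler_wpM2r => //; exact: ltW.
have d0 : delta <= 0 by lra.
apply/eqP; rewrite -subr_eq0; apply/eqP/cabs_eq0; apply: le_trans d0.
rewrite /delta (bigD1 i) //= lerDl; apply: sumr_ge0 => k _; exact: cabs_ge0.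
Qed.

End Injectivity.

(** * Choice of the radii and both directions of the inverse *)

Theorem theorem2p3 (R : realType) (n : nat) (H : 'I_n -> mi n -> R[i])
  (HFconv : exists2 r : R[i], 0 < r &
     forall x : 'I_n -> R[i], polydisc r x ->
       forall i, exists v, ps_val (hcoef H i) x v)
  (HA : cvgn (fun N => \sum_(k < N) (Amat H) ^+ k)) :
  exists g : 'I_n -> mi n -> R[i],
    (* g_{i,alpha} is the sum over S_{i,alpha} of the tree weights *)
    (forall i a, gpartial H i a N @[N --> \oo] --> g i a) /\
    (* G := (sum_alpha g_{i,alpha} X^alpha)_i is an analytic inverse of F near 0 *)
    (exists2 r : R[i], 0 < r &
       forall y : 'I_n -> R[i], polydisc r y ->
         exists x : 'I_n -> R[i],
           (forall i, ps_val (g i) y (x i)) /\ Fval H x y) /\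
    (exists2 s : R[i], 0 < s &
       forall x : 'I_n -> R[i], polydisc s x ->
         exists y : 'I_n -> R[i],
           Fval H x y /\ (forall i, ps_val (g i) y (x i))).
Proof.
have [s1 [M [s1_gt0 kM]]] := kweight_summable HFconv.
have [tau [B [tau1 B0 powA]]] := matrix_powers_decay HA.
have M0 : 0 <= M by have := kM 0; rewrite big_ord0.
have tau0 : 0 < tau by apply: lt_trans tau1.
(* With this constant the quadratic term in [small] is c * s0^2. *)
pose c := tau * B * M / s1 ^+ 2.
have c0 : 0 <= c.
  exact: (divr_ge0 (mulr_ge0 (mulr_ge0 (ltW tau0) B0) M0) (exprn_ge0 2 (ltW s1_gt0))).
(* Chosen to satisfy both 2 s0 <= s1 and c * s0 <= 1/4, including when c = 0. *)
pose s0 := s1 / 2 / (1 + 2 * c * s1).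
have den : 0 < 1 + 2 * c * s1 by have := mulr_ge0 c0 (ltW s1_gt0); lra.
have s0_gt0 : 0 < s0 by rewrite /s0 !divr_gt0.
have s0E : s0 * (1 + 2 * c * s1) = s1 / 2 by rewrite /s0 divfK // gt_eqF.
have s01 : 2 * s0 <= s1.
  by have := mulr_ge0 (ltW s0_gt0) (mulr_ge0 c0 (ltW s1_gt0)); move: s0E; lra.
have cs0 : c * s0 <= 1 / 4.
  have : (4 * c * s0) * s1 <= 1 * s1 by move: s0E s0_gt0; rewrite mulrDr mulr1; lra.
  by rewrite ler_pM2r //; lra.
(* Makes the linear term tau * B * n * rho at most s0 / 2; the quadratic one is at most s0 / 4. *)
pose rho := s0 / (2 * (tau * B * n%:R + 1)).
have tBn : 0 <= tau * B * n%:R by rewrite mulr_ge0 ?mulr_ge0 // ltW.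
have rho_den : 0 < 2 * (tau * B * n%:R + 1) by rewrite mulr_gt0 // ltr_wpDl.
have rho_gt0 : 0 < rho by rewrite divr_gt0.
have rhoE : rho * (2 * (tau * B * n%:R + 1)) = s0 by rewrite divfK // gt_eqF.
have small : tau * B * (n%:R * rho + (s0 / s1) ^+ 2 * M) <= s0.
  have -> : tau * B * (n%:R * rho + (s0 / s1) ^+ 2 * M) =
      tau * B * n%:R * rho + c * s0 * s0.
    by rewrite /c exprMn exprVn; ring.
  have : c * s0 * s0 <= 1 / 4 * s0 by apply: ler_wpM2r => //; exact: ltW.
  by move: rhoE; lra.
have /choice[h hcvg] ia := gpartial_cvg tau1 powA s1_gt0 s0_gt0 s01 kM rho_gt0 small ia.1 ia.2.
pose g i a := h (i, a).
have gcvg i a : gpartial H i a N @[N --> \oo] --> g i a by exact: (hcvg (i, a)).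
have inverse y (yrho : forall j, cabs (y j) <= rho) :=
  inverse_exists tau1 powA s1_gt0 s0_gt0 s01 kM rho_gt0 small gcvg yrho.
exists g; split; first exact: gcvg.
split.
  exists (real_complex R rho); first by rewrite ltcR.
  move=> y yr; have [j|x [gx Fx _]] := inverse y; last by exists x.
  by have := yr j; rewrite normr_cabs ltcR => /ltW.
(* The first bound puts x in the region of injectivity; the second forces y = F(x) into the polydisc
   of radius rho. *)
pose s := Num.min s0 (rho / (1 + M / s1)).
have Ms : 0 <= M / s1 by rewrite divr_ge0 // ltW.
have s_gt0 : 0 < s by rewrite lt_min s0_gt0 divr_gt0 // ltr_pwDl.
have s_rho : s + s / s1 * M <= rho.
  have : s <= rho / (1 + M / s1) by rewrite ge_min lexx orbT.
  rewrite ler_pdivlMr ?ltr_pwDl // mulrDr mulr1.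
  by rewrite (_ : s / s1 * M = s * (M / s1)) //; ring.
have ss0 : s <= s0 by rewrite ge_min lexx.
have ss1 : s <= s1 by lra.
exists (real_complex R s); first by rewrite ltcR.
move=> x xs; have xs' j : cabs (x j) <= s.
  by have := xs j; rewrite normr_cabs ltcR => /ltW.
(* There is no constant term, so the majorant scales at least linearly with the radius. *)
have kMs D : \sum_(m < D) kweight H m.+1 * s ^+ m.+1 <= s / s1 * M.
  apply: (@le_trans _ _ (s / s1 * \sum_(m < D) kweight H m.+1 * s1 ^+ m.+1)).
    rewrite mulr_sumr; apply: ler_sum => m _.
    rewrite [leRHS]mulrCA; apply: ler_wpM2l; first exact: kweight_ge0.
    rewrite !exprS mulrA divfK ?gt_eqF //; apply: ler_wpM2l; first exact: ltW.
    by rewrite lerXn2r ?nnegrE // ltW.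
  by apply: ler_wpM2l => //; rewrite divr_ge0 // ltW.
have hx i N := @pabssum_hcoef_le _ _ _ _ _ kMs x i N xs'.
have /choice[v xv] i := psum_cvg (hx i).
pose y i := x i - v i.
have Fx : Fval H x y.
  move=> i; exists (v i); split=> //; split; last exact: xv.
  by exists (real_complex R (s / s1 * M)) => N; exact: hx.
have v_le i : cabs (v i) <= s / s1 * M.
  apply: (cabs_cvg_le (xv i)); exists 0%N => N _; rewrite -lecR -normr_cabs.
  by apply: le_trans (hx i N); exact: ler_norm_sum.
have yrho j : cabs (y j) <= rho.
  apply: le_trans (cabsD _ _) _; rewrite cabsN; apply: le_trans s_rho.
  by apply: lerD.
(* The series at y = F(x) gives some z with F(z) = y and |z| <= s0; injectivity will identify z with
   x. *)
have [z [gz Fz zs0]] := inverse y yrho.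
exists y; split; first exact: Fx.
move=> i.
have /choice[w Fw] := Fz.
suff -> : x i = z i by exact: gz.
have A_small : exists N, mxabs (Amat H ^+ N) < 1 / 4.
  have q0 : 0 < 1 / 4 :> R by lra.
  by have [N AN] := powers_small HA q0; exists N; exact: AN.
have powB D : \sum_(k < D) mxabs (Amat H ^+ k) <= B.
  apply: le_trans (powA D); apply: ler_sum => k _.
  by rewrite ler_peMr ?mxabs_ge0 // exprn_ege1 // ltW.
(* Since tau >= 1, the left side is at most 2 c s0. *)
have smallB : B * (2 * s0 * M / s1 ^+ 2) <= 1 / 2.
  have : B * M / s1 ^+ 2 * s0 <= c * s0.
    apply: ler_wpM2r; first exact: ltW.
    rewrite /c; apply: ler_wpM2r; first by rewrite invr_ge0 exprn_ge0 // ltW.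
    by apply: ler_wpM2r => //; rewrite ler_peMl // ltW.
  rewrite (_ : B * (2 * s0 * M / s1 ^+ 2) = 2 * (B * M / s1 ^+ 2 * s0)); last by ring.
  by lra.
have xs0 j : cabs (x j) <= s0 by apply: le_trans (xs' j) ss0.
have zw j : psum (hcoef H j) z N @[N --> \oo] --> w j by exact: (Fw j).1.2.
have F_eq j : x j - v j = z j - w j by exact: (Fw j).2.
exact: (F_injective s1_gt0 (ltW s0_gt0) s01 kM powB smallB A_small xs0 zs0 xv zw F_eq).
Qed.
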